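(* Let $S$ be a one-dimensional Cohen-Macaulay homogeneous graded ring over a field $k$, which is not Gorenstein and has minimal multiplicity. Let $\mathfrak n$ be the graded maximal ideal of $S$, let $x$ be a minimal reduction of $\mathfrak n$, i.e. $x\in\mathfrak n$ with $x\mathfrak n=\mathfrak n^2$, and set $R=S/x^2S$. Then the $R$-module $k$ has no $\mathcal G(R)$-approximation.
   Context: A homogeneous graded ring over $k$ is a residue ring of a polynomial ring over $k$ in finitely many variables, all of degree one, by a homogeneous ideal; its graded maximal ideal is generated by the elements of positive degree. A Cohen-Macaulay ring $S$ with (graded) maximal ideal $\mathfrak n$ has minimal multiplicity if there is a system of parameters $\underline x=x_1,\dots,x_d$ with $\underline x\,\mathfrak n=\mathfrak n^2$. The $R$-module $k$ is the residue field $R/\mathfrak nR$. A finitely generated $R$-module $M$ has G-dimension zero if (i) the natural map $M\to \mathrm{Hom}_R(\mathrm{Hom}_R(M,R),R)$ is an isomorphism, (ii) $\mathrm{Ext}^i_R(M,R)=0$ for all $i>0$, and (iii) $\mathrm{Ext}^i_R(\mathrm{Hom}_R(M,R),R)=0$ for all $i>0$. $\mathcal G(R)$ denotes the full subcategory of the category of finitely generated $R$-modules consisting of the modules of G-dimension zero. A (right) $\mathcal G(R)$-approximation of a finitely generated $R$-module $M$ is a homomorphism $\pi:X\to M$ occurring in an exact sequence $0\to Y\to X\xrightarrow{\pi} M\to 0$ of finitely generated $R$-modules with $X\in\mathcal G(R)$, such that any homomorphism from any object of $\mathcal G(R)$ to $M$ factors through $\pi$. *)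

(* Defs.v *)
From HB Require Import structures.
From mathcomp Require Import all_boot all_order all_algebra.
From mathcomp Require Import boolp classical_sets functions.
From mathcomp Require Import mpoly.

Set Implicit Arguments.
Unset Strict Implicit.
Unset Printing Implicit Defensive.

Import GRing.Theory.
Local Open Scope classical_set_scope.
Local Open Scope ring_scope.

Section Ideals.
Context {S : comNzRingType}.
Implicit Types (I J A m : set S).

Definition is_ideal I :=
  [/\ I 0, forall a b, I a -> I b -> I (a + b) & forall c a, I a -> I (c * a)].

Definition ideal_gen A : set S :=
  [set s | exists (n : nat) (c a : 'I_n -> S),
     (forall i, A (a i)) /\ s = \sum_i c i * a i].

Definition ideal_mul I J : set S :=
  ideal_gen [set s | exists a b, [/\ I a, J b & s = a * b]].

Definition radical I : set S := [set s | exists N : nat, I (s ^+ N)].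

Definition prime_ideal I :=
  [/\ is_ideal I, ~ I 1 & forall a b, I (a * b) -> I a \/ I b].

Definition max_ideal m :=
  [/\ is_ideal m, ~ m 1 &
      forall I, is_ideal I -> ~ I 1 -> m `<=` I -> I `<=` m].

(* The chain P 0 < P 1 < ... < P d; the values of P beyond d are irrelevant. *)
Definition prime_chain (d : nat) (P : nat -> set S) :=
  (forall i, (i <= d)%N -> prime_ideal (P i)) /\
  (forall i, (i < d)%N -> P i `<` P i.+1).

Definition height m (d : nat) :=
  (exists2 P, prime_chain d P & P d = m) /\
  ~ (exists2 P, prime_chain d.+1 P & P d.+1 = m).

Definition regular_seq (s : seq S) :=
  (forall i b, (i < size s)%N ->
     ideal_gen [set` take i s] (s`_i * b) -> ideal_gen [set` take i s] b) /\
  ~ ideal_gen [set` s] 1.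

Definition grade I (d : nat) :=
  (exists s : seq S, [/\ regular_seq s, size s = d & [set` s] `<=` I]) /\
  ~ (exists s : seq S, [/\ regular_seq s, size s = d.+1 & [set` s] `<=` I]).

End Ideals.

Definition krull_dim (S : comNzRingType) (d : nat) :=
  (exists P : nat -> set S, prime_chain d P) /\
  ~ (exists P : nat -> set S, prime_chain d.+1 P).

Definition noetherian (S : comNzRingType) :=
  forall I : set S, is_ideal I -> exists s : seq S, I = ideal_gen [set` s].

(* For m maximal, height m = dim S_m and grade m = depth S_m. *)
Definition cohen_macaulay (S : comNzRingType) :=
  noetherian S /\
  forall m : set S, max_ideal m -> exists d, height m d /\ grade m d.

Section Modules.
Context {R : comNzRingType}.

Definition fin_gen (M : lmodType R) :=
  exists (n : nat) (e : 'I_n -> M),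
    forall v : M, exists c : 'I_n -> R, v = \sum_i c i *: e i.

Definition is_onto (A B : Type) (f : A -> B) := forall b, exists a, f a = b.

Definition exact (A B C : lmodType R) (f : A -> B) (g : B -> C) :=
  forall b, g b = 0 <-> exists a, f a = b.

Definition projective (P : lmodType R) :=
  forall (A B : lmodType R) (p : {linear A -> B}), is_onto p ->
  forall f : {linear P -> B},
  exists g : {linear P -> A}, forall v, p (g v) = f v.

Definition injective_module (E : lmodType R) :=
  forall (A B : lmodType R) (j : {linear A -> B}), injective j ->
  forall f : {linear A -> E},
  exists g : {linear B -> E}, forall a, g (j a) = f a.

(* ... -> P 2 -> P 1 -> P 0 -> M -> 0 *)
Record proj_resolution (M : lmodType R) := ProjResolution {
  pr_obj : nat -> lmodType R;
  pr_diff : forall i, {linear pr_obj i.+1 -> pr_obj i};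
  pr_aug : {linear pr_obj 0 -> M};
  pr_proj : forall i, projective (pr_obj i);
  pr_surj : is_onto pr_aug;
  pr_exact0 : exact (pr_diff 0) pr_aug;
  pr_exact : forall i, exact (pr_diff i.+1) (pr_diff i) }.

(* Ext^(i+1)(M, N) = 0, i.e. Hom(P, N) has no cohomology in degree i + 1, for a
   projective resolution P of M. Every module has one, and the condition does
   not depend on it. *)
Definition ExtS_vanishes (i : nat) (M N : lmodType R) :=
  forall (P : proj_resolution M) (g : {linear pr_obj P i.+1 -> N}),
    (forall v, g (pr_diff P i.+1 v) = 0) ->
    exists h : {linear pr_obj P i -> N}, forall v, g v = h (pr_diff P i v).

(* 0 -> M -> E 0 -> E 1 -> ... -> E d -> 0 *)
Definition finite_inj_dim (M : lmodType R) :=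
  exists (d : nat) (E : nat -> lmodType R) (e : {linear M -> E 0})
         (D : forall i, {linear E i -> E i.+1}),
  [/\ forall i, injective_module (E i), injective e,
      exact e (D 0), forall i, exact (D i) (D i.+1) &
      forall i (v : E i), (d < i)%N -> v = 0].

End Modules.

(* f identifies T with the localization of S at the prime ideal p. *)
Definition is_localization (S T : comNzRingType) (p : set S)
    (f : {rmorphism S -> T}) :=
  [/\ forall s, ~ p s -> exists t, f s * t = 1,
      forall t, exists a s, ~ p s /\ f s * t = f a &
      forall a, f a = 0 -> exists s, ~ p s /\ s * a = 0].

Definition gorenstein (S : comNzRingType) :=
  noetherian S /\
  forall (m : set S) (T : comNzRingType) (f : {rmorphism S -> T}),
    max_ideal m -> is_localization m f -> finite_inj_dim T^o.

Section Dual.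
Variables (R : comNzRingType) (M : lmodType R).

Definition dual_pred : {pred M -> R^o} := [pred f | `[< linear f >]].

Lemma dual_submod_closed : submod_closed dual_pred.
Proof.
split=> [|a f g /asboolP lf /asboolP lg].
  by apply/asboolP => c u v; rewrite /= scaler0 addr0.
apply/asboolP => c u v.
rewrite /= -[LHS]/(a *: f (c *: u + v) + g (c *: u + v)).
rewrite -[RHS]/(c *: (a *: f u + g u) + (a *: f v + g v)).
by rewrite lf lg !scalerDr !scalerA [c * a]mulrC addrACA.
Qed.

HB.instance Definition _ :=
  GRing.isSubmodClosed.Build R (M -> R^o) dual_pred dual_submod_closed.

(* Hom_R(M, R) with its pointwise module structure *)
Record dual := Dual { dual_fun :> M -> R^o; _ : dual_fun \in dual_pred }.

HB.instance Definition _ := [isSub for dual_fun].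
HB.instance Definition _ := [Choice of dual by <:].
HB.instance Definition _ := [SubChoice_isSubLmodule of dual by <:].

End Dual.

Section Biduality.
Variables (R : comNzRingType) (M : lmodType R).

Lemma eval_subproof (v : M) :
  (fun f : dual M => f v : R^o) \in @dual_pred R (dual M).
Proof. by apply/asboolP => a f g. Qed.

Definition biduality (v : M) : dual (dual M) := Dual (eval_subproof v).

End Biduality.

Definition Gdim0 (R : comNzRingType) (M : lmodType R) :=
  [/\ fin_gen M, bijective (@biduality R M),
      forall i, ExtS_vanishes i M R^o &
      forall i, ExtS_vanishes i (dual M) R^o].

Definition G_approximation (R : comNzRingType) (X M : lmodType R)
    (pi : {linear X -> M}) :=
  [/\ exists (Y : lmodType R) (j : {linear Y -> X}),
        [/\ fin_gen Y, injective j, exact j pi & is_onto pi],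
      Gdim0 X &
      forall (Z : lmodType R) (f : {linear Z -> M}), Gdim0 Z ->
        exists g : {linear Z -> X}, forall z, f z = pi (g z)].

Section Homogeneous.
Variables (k : fieldType) (r : nat) (S : comNzRingType).
Variable phi : {rmorphism {mpoly k[r]} -> S}.

(* phi presents S as the residue ring of k[X_1, ..., X_r] by a homogeneous
   ideal: the kernel of phi is generated by homogeneous polynomials. *)
Definition homogeneous_presentation :=
  is_onto phi /\
  exists G : set {mpoly k[r]},
    (forall p, G p -> exists d, p \is d.-homog) /\
    forall p, phi p = 0 <-> ideal_gen G p.

Definition graded_max_ideal : set S :=
  ideal_gen [set s | exists d p,
    [/\ (0 < d)%N, p \is d.-homog & s = phi p]].

End Homogeneous.

Definition system_of_parameters (S : comNzRingType) (n : set S) (s : seq S) :=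
  [/\ krull_dim S (size s), [set` s] `<=` n & radical (ideal_gen [set` s]) = n].

Definition minimal_multiplicity (S : comNzRingType) (n : set S) :=
  exists2 s : seq S, system_of_parameters n s &
    ideal_mul (ideal_gen [set` s]) n = ideal_mul n n.

Definition minimal_reduction (S : comNzRingType) (n : set S) (x : S) :=
  n x /\ [set x * s | s in n] = ideal_mul n n.

(* Main.v *)
Require Import Defs.
From HB Require Import structures.
From mathcomp Require Import all_boot all_order all_algebra.
From mathcomp Require Import boolp classical_sets functions.
From mathcomp Require Import mpoly ring.

(** Let [m] be the maximal ideal of [R].  As [x n = n^2] and [x] is regular,
    [m^2 = x m], [m^3 = 0] and [0 : x = x R]; since [S] is not Gorenstein,
    [m / x R] contains two independent elements [y1], [y2].

    For each [n] put [M_n = R[t] / (t^(n+1), x - y1 t)].  It has generators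
    [e_0, ..., e_n] with [x e_0 = 0] and [x e_j = y1 e_(j-1)], and it has
    G-dimension zero because [x - y1 t] divides [x^2] over [S[t] / t^(n+1)]
    (a matrix factorization of [x^2]).  If [X -> k] is an approximation, the map
    [M_n -> k] sending [e_0] to [1] and the other generators to [0] factors
    through [X], so [X] contains elements [u_0, ..., u_n] satisfying the same
    relations, [u_0] being mapped to [1].

    Embed [X] in the complex [F_0 -> F_1 -> ...] dual to a minimal free
    resolution of [X^*]; it is exact, and so is its dual.  Writing
    [u = (x^2 / (x - y1 t)) f] and applying the differential to [f] gives a
    sequence of the same kind, one step shorter, in the next cosyzygy, whose
    first term stays away from the socle since [m / x R] has dimension at least
    two.  By induction on [n] the [u_j] are linearly independent over [k] in
    [F_0], which is absurd for large [n]. *)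

Set Implicit Arguments.
Unset Strict Implicit.
Unset Printing Implicit Defensive.

Import GRing.Theory.
Local Open Scope classical_set_scope.
Local Open Scope ring_scope.

(** * Quotients, images and Baer's criterion *)

(** The hypothesis that [S] is not Gorenstein is used by contraposition: if [n = x S + k y] for a
    single [y], then [S] is free of rank one or two over [k[x1]], with [x1] the linear part of [x],
    and self-dual over it. Since Gorenstein means finite injective dimension of the localizations,
    an injective resolution has to be built and then localized; Baer's criterion and coinduced
    modules serve this purpose.

    In the tower argument the factors [p = x - y1 t] and [q = x^2 / (x - y1 t)] exchange roles at
    each passage to the next cosyzygy. The induction therefore runs over all pairs of series with
    symmetric properties: coefficients in [m], constant term [x], linear term outside [x R], each
    generating the annihilator of the other.

    Independence is needed modulo [m^2 F], not just over [k], because the form that separates the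
    last vector from the others is only controlled modulo [x R]. *)

Lemma add_self0 (V : zmodType) (v : V) : v = v + v -> v = 0.
Proof. by rewrite -{1}[v]addr0 => /addrI. Qed.

Definition mklin (R : comNzRingType) (A B : lmodType R) (f : A -> B)
  (lf : linear f) : {linear A -> B} :=
  HB.pack f (GRing.isLinear.Build _ _ _ _ f lf).

Section MkLmod.
Variables (R : comNzRingType) (Z : zmodType) (scale : R -> Z -> Z).
Hypothesis scaleA : forall a b v, scale a (scale b v) = scale (a * b) v.
Hypothesis scale1 : left_id 1 scale.
Hypothesis scaleDr : right_distributive scale +%R.
Hypothesis scaleDl : forall v, {morph scale^~ v : a b / a + b}.
(** An alias of [Z] that keeps the new scaling apart from any module structure declared on [Z]
    itself. *)
Definition lmod_carrier : Type := Z.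
HB.instance Definition _ := GRing.Zmodule.on lmod_carrier.
HB.instance Definition _ :=
  GRing.Zmodule_isLmodule.Build R lmod_carrier scaleA scale1 scaleDr scaleDl.
Definition mklmod : lmodType R := lmod_carrier.
End MkLmod.

Definition submodule (R : comNzRingType) (M : lmodType R) (W : set M) :=
  [/\ W 0, forall u v, W u -> W v -> W (u + v) & forall c v, W v -> W (c *: v)].

Section Quotient.
Variables (R : comNzRingType) (M : lmodType R) (W : set M).
Hypothesis Wsub : submodule W.

Let W0 : W 0. Proof. by case: Wsub. Qed.
Let WD u v : W u -> W v -> W (u + v). Proof. by case: Wsub => _ h _; apply: h. Qed.
Let WZ c v : W v -> W (c *: v). Proof. by case: Wsub => _ _; apply. Qed.
Let WN v : W v -> W (- v). Proof. by rewrite -scaleN1r; apply: WZ. Qed.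

(** One chosen representative per coset. The quotient is the subtype of fixed points of [canon], so
    its choice structure comes from [M]. *)
Let canon (v : M) : M := xget 0 [set w | W (w - v)].

Let canonP v : W (canon v - v).
Proof.
rewrite /canon; apply: (@xgetPex _ 0 [set w | W (w - v)]).
by exists v; rewrite /= subrr.
Qed.

Let canonE u v : W (u - v) -> canon u = canon v.
Proof.
move=> Wuv; rewrite /canon; congr xget; apply/seteqP; split=> w /= Ww.
  by rewrite -(subrKA u); apply: WD.
by rewrite -(subrKA v); apply: WD => //; rewrite -opprB; apply: WN.
Qed.

Let canonK v : canon (canon v) = canon v.
Proof. exact/canonE/canonP. Qed.

Record quotient := Quotient { quot_val : M; _ : canon quot_val == quot_val }.
HB.instance Definition _ := [isSub for quot_val].
HB.instance Definition _ := [Choice of quotient by <:].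

Let cl (v : M) : quotient := Quotient (introT eqP (canonK v)).
Let clE u v : W (u - v) -> cl u = cl v.
Proof. by move=> Wuv; apply: val_inj; apply: canonE. Qed.
Let cl_val a : cl (quot_val a) = a.
Proof. by apply: val_inj => /=; apply/eqP; case: a. Qed.
Let val_cl v : W (quot_val (cl v) - v).
Proof. exact: canonP. Qed.
Let clP u v : cl u = cl v -> W (u - v).
Proof.
move=> /(congr1 quot_val) /= e; rewrite -(subrKA (canon u)); apply: WD.
  by rewrite -opprB; apply/WN/canonP.
by rewrite e; apply: canonP.
Qed.

Let qadd a b := cl (quot_val a + quot_val b).
Let qopp a := cl (- quot_val a).
Let qscale c a := cl (c *: quot_val a).
Let qaddE u v : qadd (cl u) (cl v) = cl (u + v).
Proof. by apply: clE; rewrite opprD addrACA; apply: WD; apply: val_cl. Qed.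
Let qscaleE c v : qscale c (cl v) = cl (c *: v).
Proof. by apply: clE; rewrite -scalerBr; apply/WZ/val_cl. Qed.
Let qoppE v : qopp (cl v) = cl (- v).
Proof. by apply: clE; rewrite -opprD; apply/WN/val_cl. Qed.

Let qaddA : associative qadd.
Proof.
by move=> a b c; rewrite -(cl_val a) -(cl_val b) -(cl_val c) !qaddE addrA.
Qed.
Let qaddC : commutative qadd.
Proof. by move=> a b; rewrite /qadd addrC. Qed.
Let qadd0 : left_id (cl 0) qadd.
Proof. by move=> a; rewrite -(cl_val a) !qaddE add0r. Qed.
Let qaddN : left_inverse (cl 0) qopp qadd.
Proof. by move=> a; rewrite -(cl_val a) qoppE qaddE addNr. Qed.

Let quotZ : zmodType :=
  HB.pack quotient (GRing.isZmodule.Build quotient qaddA qaddC qadd0 qaddN).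

Let qscaleA a b v : qscale a (qscale b v) = qscale (a * b) v.
Proof. by rewrite -(cl_val v) !qscaleE scalerA. Qed.
Let qscale1 : left_id 1 qscale.
Proof. by move=> a; rewrite -(cl_val a) qscaleE scale1r. Qed.
Let qscaleDr : right_distributive qscale (@GRing.add quotZ).
Proof.
move=> c a b; rewrite -(cl_val a) -(cl_val b).
by rewrite [_ + _]qaddE !qscaleE [RHS]qaddE scalerDr.
Qed.
Let qscaleDl v : {morph (fun a => qscale a v : quotZ): a b / a + b}.
Proof.
by move=> a b; rewrite -(cl_val v) !qscaleE [RHS]qaddE scalerDl.
Qed.

Let quotL : lmodType R :=
  @mklmod R quotZ qscale qscaleA qscale1 qscaleDr qscaleDl.

Lemma quotient_exists : exists (Q : lmodType R) (p : {linear M -> Q}),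
  is_onto p /\ forall v, p v = 0 <-> W v.
Proof.
have lin : linear (cl : M -> quotL).
  by move=> a u v; rewrite -[RHS]/(qadd (qscale a (cl u)) (cl v)) qscaleE qaddE.
exists quotL, (mklin lin); split=> [a|v]; first by exists (quot_val a); apply: cl_val.
split=> [/clP|Wv]; first by rewrite subr0.
by apply: clE; rewrite subr0.
Qed.

End Quotient.

(** The image is realized as the quotient by the kernel: [d] composed with any section [s] of the
    projection does not depend on the section. *)
Lemma image_exists (R : comNzRingType) (A B : lmodType R) (d : {linear A -> B}) :
  exists (I : lmodType R) (j : {linear I -> B}),
    injective j /\ forall b, (exists a, d a = b) <-> exists i, j i = b.
Proof.
have Wsub : submodule [set a | d a = 0].
  split=> [|u v /= du dv|c v /= dv]; first exact: linear0.
    by rewrite linearD du dv addr0.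
  by rewrite linearZ /= dv scaler0.
have [Q [p [p_onto p_ker]]] := quotient_exists Wsub.
have [s sK] := choice p_onto.
have dE u v : p u = p v -> d u = d v.
  move=> e; apply/eqP; rewrite -subr_eq0 -linearB; apply/eqP/p_ker.
  by rewrite linearB e subrr.
have lin : linear (d \o s).
  by move=> a u v /=; rewrite -linearP; apply: dE; rewrite linearP !sK.
exists Q, (mklin lin); split=> [u v /= /eqP|b].
  rewrite -subr_eq0 -linearB => /eqP /p_ker.
  by rewrite linearB !sK => /eqP; rewrite subr_eq0 => /eqP.
split=> [[a <-]|[i <-]]; last by exists (s i).
by exists (p a) => /=; apply: dE; rewrite sK.
Qed.

(** Baer's condition. The function [h] lives on the whole ring and is constrained on [I] only, which
    avoids turning the ideal into a module. *)
Definition ideal_injective (A : comNzRingType) (E : lmodType A) :=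
  forall (I : set A) (h : A -> E), is_ideal I ->
    (forall c a b, I a -> I b -> h (c * a + b) = c *: h a + h b) ->
    exists e, forall a, I a -> h a = a *: e.

Section Baer.
Variables (A : comNzRingType) (E M : lmodType A).
Hypothesis E_inj : ideal_injective E.

(** Partial linear maps are encoded by their graphs, which Zorn's lemma can order by inclusion; the
    second clause expresses single-valuedness. *)
Let linear_graph (D : set (M * E)) :=
  (forall c p q, D p -> D q -> D (c *: p + q)) /\ (forall e, D (0, e) -> e = 0).

(** The scalars [a] with [a v] in the domain form an ideal that [D] maps linearly to [E], hence by
    [a |-> a e0]. Adjoining [(v, e0)] keeps the graph single-valued, so maximality puts [v] in the
    domain. *)
Let total_graph (D : set (M * E)) : linear_graph D -> D (0, 0) ->
  (forall D', linear_graph D' -> D `<=` D' -> D' `<=` D) ->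
  forall v, exists e, D (v, e).
Proof.
move=> [DP D0] D00 Dmax v; pose I := [set a | exists e, D (a *: v, e)].
have DZ c p : D p -> D (c *: p) by move=> Dp; rewrite -[_ *: p]addr0; apply: DP.
have DD p q : D p -> D q -> D (p + q).
  by move=> Dp Dq; rewrite -[p]scale1r; apply: DP.
have Dfun u a b : D (u, a) -> D (u, b) -> a = b.
  move=> Da Db; apply/eqP; rewrite -subr_eq0; apply/eqP/D0.
  have := DP (-1) _ _ Db Da.
  by rewrite scaleN1r addrC -[_ - _]/(u - u, a - b) subrr.
have I_ideal : is_ideal I.
  split; first by exists 0; rewrite scale0r.
    move=> a b [e De] [e' De']; exists (e + e'); rewrite scalerDl; exact: DD De De'.
  move=> c a [e De]; exists (c *: e); rewrite -scalerA; exact: (DZ c _ De).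
have [h hP] : exists h : A -> E, forall a, I a -> D (a *: v, h a).
  have /choice[h hP] : forall a, exists e, I a -> D (a *: v, e).
    move=> a; have [[e De]|nI] := pselect (I a); first by exists e.
    by exists 0.
  by exists h.
have [|e0 he0] := E_inj I_ideal (h := h).
  move=> c a b Ia Ib; have Icab : I (c * a + b).
    by case: I_ideal => _ ID IM; apply: ID => //; apply: IM.
  apply: Dfun (hP _ Icab) _; rewrite scalerDl -scalerA.
  exact: (DP c _ _ (hP _ Ia) (hP _ Ib)).
pose D' := [set p : M * E | exists q a, D q /\ p = q + a *: (v, e0)].
suff : D' `<=` D.
  move=> /(_ (v, e0)) sub; exists e0; apply: sub.
  by exists (0, 0), 1; rewrite scale1r add0r.
apply: Dmax => [|p Dp]; last by exists p, 0; rewrite scale0r addr0.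
split=> [c _ _ [p [a [Dp ->]]] [q [b [Dq ->]]]|e [[u d] [a [Dud]]]].
  exists (c *: p + q), (c * a + b); split; first exact: DP.
  by rewrite scalerDr scalerDl addrACA scalerA.
rewrite -[_ + _]/(u + a *: v, d + a *: e0) => -[/esym/eqP]; rewrite addr_eq0 => /eqP ue ->.
have Dav : D (a *: v, - d).
  by have := DZ (-1) _ Dud; rewrite -[_ *: _]/(-1 *: u, -1 *: d) !scaleN1r ue opprK.
have Ia : I a by exists (- d).
by rewrite -(he0 _ Ia) (Dfun _ _ _ (hP _ Ia) Dav) subrr.
Qed.

Lemma baer_extend (N : set M) (g : M -> E) : submodule N ->
  (forall c u v, N u -> N v -> g (c *: u + v) = c *: g u + g v) ->
  exists G : {linear M -> E}, forall v, N v -> G v = g v.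
Proof.
move=> [N0 ND NZ] gP; pose G0 := [set p : M * E | N p.1 /\ p.2 = g p.1].
have g0 : g 0 = 0.
  have := gP 1 0 0 N0 N0; rewrite !scale1r addr0; exact: add_self0.
have G0good : linear_graph G0.
  split=> [c [u a] [v b] [/= Nu ->] [/= Nv ->]|e [_ /= ->]] //.
  by split=> /=; [apply: ND => //; apply: NZ | rewrite gP].
(* The condition is imposed on the union of [D] with [G0], so that the empty chain satisfies it as
   well. *)
have [F F_tot|G [Ggood Gmax]] :=
    @Zorn_bigcup (M * E)%type (fun D => linear_graph (D `|` G0)).
  move=> FP; have sub D : F D -> D `<=` \bigcup_(X in F) X.
    by move=> FD p Dp; exists D.
  split=> [c p q|e].
    have key D : F D -> (D `|` G0) p -> (D `|` G0) q ->
        (\bigcup_(X in F) X `|` G0) (c *: p + q).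
      move=> FD Dp Dq; have [h _] := F_tot _ FD.
      by case: (h c p q Dp Dq) => [Dpq|]; [left; apply: (sub D) | right].
    case=> [[D1 F1 D1p]|G0p]; case=> [[D2 F2 D2q]|G0q].
    - have [s12|s21] := FP _ _ F1 F2.
        by apply: (key D2 F2); left => //; apply: s12.
      by apply: (key D1 F1); left => //; apply: s21.
    - by apply: (key D1 F1); [left|right].
    - by apply: (key D2 F2); [right|left].
    - by right; case: G0good => h _; apply: h.
  case=> [[D FD De]|]; last by case: G0good => _; apply.
  by have [_] := F_tot _ FD; apply; left.
pose D := G `|` G0.
have Dtot : forall v, exists e, D (v, e).
  apply: total_graph => // [|D' D'good sub].
    by right; split => //=; rewrite g0.
  have D'G0 : D' `|` G0 = D'.
    by apply/seteqP; split=> p; [case=> // Gp; apply: sub; right | left].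
  apply: contrapT => nsub; apply: (Gmax D'); last by rewrite D'G0.
  split; first by move=> p Gp; apply: sub; left.
  by move=> sub'; apply: nsub => p D'p; left; apply: sub'.
have [f fP] := choice Dtot; have [DP D0] := Ggood.
have Dfun u a b : D (u, a) -> D (u, b) -> a = b.
  move=> Da Db; apply/eqP; rewrite -subr_eq0; apply/eqP/D0.
  have := DP (-1) _ _ Db Da.
  by rewrite scaleN1r addrC -[_ - _]/(u - u, a - b) subrr.
have lin : linear f.
  move=> c u v; apply: Dfun (fP _) _.
  exact: (DP c _ _ (fP u) (fP v)).
by exists (mklin lin) => v Nv; apply: Dfun (fP v) _; right.
Qed.

End Baer.

Lemma ideal_injectiveP (A : comNzRingType) (E : lmodType A) :
  ideal_injective E -> injective_module E.
Proof.
move=> E_inj B C j j_inj f.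
have [r rP] : exists r : C -> B, forall b, r (j b) = b.
  have /choice[r rP] : forall c, exists b, (exists b', j b' = c) -> j b = c.
    move=> c; have [[b <-]|no] := pselect (exists b', j b' = c); first by exists b.
    by exists 0 => /no.
  by exists r => b; apply: j_inj; apply: rP; exists b.
have [||G GP] := baer_extend E_inj (N := [set c | exists b, j b = c]) (g := f \o r).
- split; first by exists 0; rewrite linear0.
    by move=> _ _ [a <-] [b <-]; exists (a + b); rewrite linearD.
  by move=> c _ [b <-]; exists (c *: b); rewrite linearZ.
- by move=> c _ _ [a <-] [b <-]; rewrite /= -linearP !rP linearP.
by exists G => a; rewrite GP /= ?rP //; exists a.
Qed.

(** * Coinduction and localization of injective modules *)

Section Coinduced.
Variables (A S : comNzRingType) (psi : {rmorphism A -> S}) (E : lmodType A).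

Let act (a : A) (s : S) : S := psi a * s.
Let actA a b v : act a (act b v) = act (a * b) v.
Proof. by rewrite /act mulrA rmorphM. Qed.
Let act1 : left_id 1 act.
Proof. by move=> s; rewrite /act rmorph1 mul1r. Qed.
Let actDr : right_distributive act +%R.
Proof. by move=> a s t; rewrite /act mulrDr. Qed.
Let actDl v : {morph act^~ v : a b / a + b}.
Proof. by move=> a b; rewrite /act rmorphD mulrDl. Qed.

Let SA : lmodType A := mklmod actA act1 actDr actDl.

Let Alinear : {pred S -> E} :=
  [pred f | `[< forall c s t, f (psi c * s + t) = c *: f s + f t >]].

Let Alinear_closed : zmod_closed Alinear.
Proof.
split=> [|f g /asboolP fP /asboolP gP]; apply/asboolP => c s t.
  by rewrite /= scaler0 addr0.
rewrite -[LHS]/(f _ - g _) -[RHS]/(c *: (f s - g s) + (f t - g t)).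
by rewrite fP gP scalerBr opprD addrACA.
Qed.

HB.instance Definition _ := GRing.isZmodClosed.Build (S -> E) Alinear Alinear_closed.

Record coind := Coind { coind_fun :> S -> E; _ : coind_fun \in Alinear }.
HB.instance Definition _ := [isSub for coind_fun].
HB.instance Definition _ := [Choice of coind by <:].
HB.instance Definition _ := [SubChoice_isSubZmodule of coind by <:].

Let coindP (f : coind) c s t : f (psi c * s + t) = c *: f s + f t.
Proof. by case: f => f /asboolP /=. Qed.

Let coindZ (f : coind) c s : f (psi c * s) = c *: f s.
Proof.
have f0 : f 0 = 0.
  have := coindP f 1 0 0; rewrite rmorph1 mul1r addr0 scale1r; exact: add_self0.
by rewrite -[psi c * s]addr0 coindP f0 addr0.
Qed.

Let coind_scale_proof (c : S) (f : coind) : (fun s => f (c * s)) \in Alinear.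
Proof. by apply/asboolP => a s t; rewrite mulrDr mulrCA coindP. Qed.
Let cscale c f := Coind (coind_scale_proof c f).

Let coind_ext (f g : coind) : (forall s, f s = g s) -> f = g.
Proof. by move=> e; apply: val_inj; apply/funext. Qed.

Let cscaleA a b f : cscale a (cscale b f) = cscale (a * b) f.
Proof. by apply: coind_ext => s /=; rewrite mulrA [b * a]mulrC. Qed.
Let cscale1 : left_id 1 cscale.
Proof. by move=> f; apply: coind_ext => s /=; rewrite mul1r. Qed.
Let cscaleDr : right_distributive cscale +%R.
Proof. by move=> a f g; apply: coind_ext. Qed.
Let cscaleDl f : {morph cscale^~ f : a b / a + b}.
Proof.
move=> a b; apply: coind_ext => s /=; rewrite mulrDl.
by rewrite -[a * s]mul1r -(rmorph1 psi) coindP scale1r.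
Qed.
Let coindL : lmodType S := mklmod cscaleA cscale1 cscaleDr cscaleDl.

(** [H] is [Hom_A(S, E)] with [S] acting on the argument, known only through its evaluation [ev].
    For injectivity, a map from an ideal of [S] to [H] is evaluated at [1], extended [A]-linearly to
    all of [S], and read back as an element of [H]. *)
Lemma coinduced_exists : exists (H : lmodType S) (ev : H -> S -> E),
  [/\ forall h c s t, ev h (psi c * s + t) = c *: ev h s + ev h t,
      forall h h', (forall s, ev h s = ev h' s) -> h = h',
      forall c h h' s, ev (c *: h + h') s = ev h (c * s) + ev h' s,
      (forall f : S -> E, (forall c s t, f (psi c * s + t) = c *: f s + f t) ->
         exists h, ev h = f) &
      ideal_injective E -> ideal_injective H].
Proof.
exists coindL, coind_fun; split.
- by move=> h c s t; apply: (coindP (h : coind)).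
- by move=> h h' e; apply: coind_ext.
- by [].
- move=> f fP; have fin : f \in Alinear by apply/asboolP.
  by exists (Coind fin).
- move=> E_inj I g [I0 ID IM] gP.
have [||G GP] := @baer_extend A E SA E_inj I (fun s => (g s : coind) 1).
- by split=> // c s Is; apply: IM.
- move=> c s t Is It; rewrite -[c *: s]/(psi c * s) (gP (psi c)) //.
  by rewrite -[LHS]/((g s : coind) (psi c * 1) + (g t : coind) 1) coindZ.
have GA : (G : S -> E) \in Alinear.
  by apply/asboolP => c s t; rewrite -[psi c * s]/((c *: (s : SA) : SA)) linearP.
exists (Coind GA : coindL) => s Is; apply: coind_ext => t.
rewrite -[RHS]/(G (s * t)) mulrC GP; last exact: IM.
have := gP t s 0 Is I0; rewrite !addr0 => ->.
have -> : g 0 = 0.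
  have := gP 1 0 0 I0 I0; rewrite scale1r mul1r addr0; exact: add_self0.
by rewrite addr0 /= mulr1.
Qed.

End Coinduced.

(** * Ideals, and submodules of free modules over a noetherian ring *)

Lemma ideal_gen_min (S : comNzRingType) (A I : set S) :
  is_ideal I -> A `<=` I -> ideal_gen A `<=` I.
Proof.
move=> [I0 ID IM] AI s [n [c [a [Aa ->]]]].
by elim/big_ind: _ => // i _; apply/IM/AI/Aa.
Qed.

Lemma ideal_gen_ideal (S : comNzRingType) (A : set S) : is_ideal (ideal_gen A).
Proof.
split.
- by exists 0, (fun=> 0), (fun=> 0); split=> [[]|] //; rewrite big_ord0.
- move=> a b [n [c [u [Au ->]]]] [n' [c' [u' [Au' ->]]]].
  exists (n + n')%N.
  exists (fun i : 'I_(n + n') => match fintype.split i with inl j => c j | inr j => c' j end).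
  exists (fun i : 'I_(n + n') => match fintype.split i with inl j => u j | inr j => u' j end).
  split=> [i|]; first by case: fintype.split.
  rewrite big_split_ord; congr (_ + _); apply: eq_bigr => i _.
    by rewrite (unsplitK (inl i)).
  by rewrite (unsplitK (inr i)).
- move=> d a [n [c [u [Au ->]]]]; exists n, (fun i => d * c i), u; split=> //.
  by rewrite mulr_sumr; apply: eq_bigr => i _; rewrite mulrA.
Qed.

Lemma ideal_gen_sub (S : comNzRingType) (A : set S) : A `<=` ideal_gen A.
Proof.
move=> a Aa; exists 1, (fun=> 1), (fun=> a); split=> //.
by rewrite big_ord1 mul1r.
Qed.

Lemma ideal_genP (S : comNzRingType) (s : seq S) (a : S) :
  ideal_gen [set` s] a <->
  exists c : 'rV[S]_(size s), a = (c *m \col_i s`_i) 0 0.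
Proof.
split=> [|[c ->]]; last first.
  exists (size s), (c 0), (fun i => s`_i); split=> [i|]; first exact: mem_nth.
  by rewrite mxE; apply: eq_bigr => i _; rewrite mxE.
apply: (@ideal_gen_min S [set` s] [set a | exists c : 'rV[S]_(size s), a = (c *m \col_i s`_i) 0 0]).
  split; first by exists 0; rewrite mul0mx mxE.
    by move=> _ _ [c ->] [d ->]; exists (c + d); rewrite mulmxDl [RHS]mxE.
  by move=> b _ [c ->]; exists (b *: c); rewrite -scalemxAl [RHS]mxE.
move=> b /= bs; have ib : (index b s < size s)%N by rewrite index_mem.
exists (delta_mx 0 (Ordinal ib)); rewrite -rowE !mxE /=.
by rewrite nth_index.
Qed.

(** Induction on [n]: the first coordinates of [W] form an ideal, and the vectors of [W] with first
    coordinate zero live in rank one less. Lifts of generators of the former and generators of the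
    latter are the rows of [B]. *)
Lemma noetherian_rV (S : comNzRingType) (n : nat) (W : set 'rV[S]_n) :
  noetherian S -> submodule W ->
  exists (m : nat) (B : 'M[S]_(m, n)), forall v, W v <-> exists c, v = c *m B.
Proof.
move=> S_noeth; elim: n W => [|n IHn] W [W0 WD WZ].
  exists 0, 0 => v; rewrite [v]thinmx0; split=> // _.
  by exists 0; rewrite mul0mx.
rewrite -[n.+1]/(1 + n)%N in W W0 WD WZ *.
have Wsum m (c : 'rV_m) (B : 'M_(m, 1 + n)) : (forall i, W (row i B)) -> W (c *m B).
  by move=> WB; rewrite mulmx_sum_row; elim/big_ind: _ => // i _; apply: WZ.
have [|l lP] := S_noeth [set a | exists v : 'rV_n, W (row_mx a%:M v)].
  split.
  - by exists 0; rewrite raddf0 row_mx0.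
  - move=> a b [u Wu] [v Wv]; exists (u + v).
    by rewrite raddfD /= -add_row_mx; apply: WD.
  - by move=> c a [u Wu]; exists (c *: u); rewrite -scale_scalar_mx -scale_row_mx; apply: WZ.
have [|m [B BP]] := IHn [set v | W (row_mx 0 v)].
  split=> [|u v Wu Wv|c v Wv] /=; first by rewrite row_mx0.
    by rewrite -[0]addr0 -add_row_mx; apply: WD.
  by rewrite -[0](scaler0 _ c) -scale_row_mx; apply: WZ.
have /choice[g gP] : forall i : 'I_(size l), exists v : 'rV_n, W (row_mx (l`_i)%:M v).
  move=> i; have : ideal_gen [set` l] l`_i by apply/ideal_gen_sub/mem_nth.
  by rewrite -lP.
pose G : 'M_(size l, 1 + n) := \matrix_i row_mx (l`_i)%:M (g i).
have GW i : W (row i G) by rewrite rowK.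
have BW i : W (row i (row_mx 0 B)).
  by rewrite row_row_mx row0; apply/BP; exists (delta_mx 0 i); rewrite rowE.
exists (size l + m)%N, (col_mx G (row_mx 0 B)) => v; split=> [Wv|[c ->]]; last first.
  by rewrite -[c]hsubmxK mul_row_col; apply: WD; apply: Wsum.
have : ideal_gen [set` l] (v 0 0).
  rewrite -lP; exists (rsubmx v); suff -> : (v 0 0)%:M = lsubmx v by rewrite hsubmxK.
  by rewrite [RHS]mx11_scalar !mxE; congr (_%:M); congr (v 0 _); apply: val_inj.
move=> /ideal_genP [c vE].
have Wd : W (v + -1 *: (c *m G)) by apply/WD/WZ/Wsum.
have wE : v + -1 *: (c *m G) = row_mx 0 (rsubmx (v - c *m G)).
  rewrite scaleN1r -[LHS]hsubmxK; congr row_mx; apply/rowP => i.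
  rewrite ord1 !mxE; apply/eqP; rewrite subr_eq0; apply/eqP.
  transitivity (v 0 0); first by congr (v 0 _); apply: val_inj.
  rewrite vE mxE; apply: eq_bigr => j _; rewrite !mxE.
  by case: splitP => // k; rewrite ord1 mxE eqxx.
move: Wd; rewrite wE => /BP[d dE]; exists (row_mx c d).
rewrite mul_row_col mul_mx_row mulmx0 -dE -wE scaleN1r.
by rewrite addrC subrK.
Qed.

Section Localization.
Variables (S T : comNzRingType) (p : set S) (f : {rmorphism S -> T}).
Hypothesis S_noeth : noetherian S.
Hypothesis p1 : ~ p 1.
Hypothesis pM : forall a b, ~ p a -> ~ p b -> ~ p (a * b).
Hypothesis f_loc : is_localization p f.
Variable E : lmodType S.
Hypothesis E_inj : ideal_injective E.

Let pX s n : ~ p s -> ~ p (s ^+ n).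
Proof. by move=> ps; elim: n => [|n IHn] //; rewrite exprS; apply: pM. Qed.

Let torsion : set E := [set e | exists s, ~ p s /\ s *: e = 0].

Let torsion_sub : submodule torsion.
Proof.
split=> [|u v [s [ps su]] [t [pt tv]]|c v [s [ps sv]]].
- by exists 1; rewrite scaler0.
- exists (s * t); split; first exact: pM.
  by rewrite scalerDr -!scalerA tv scaler0 addr0 scalerA mulrC -scalerA su scaler0.
- by exists s; split=> //; rewrite scalerA mulrC -scalerA sv scaler0.
Qed.

Let annihilators_stabilize (s : S) :
  exists n, forall a k, s ^+ k * a = 0 -> s ^+ n * a = 0.
Proof.
have [|l lP] := S_noeth (I := [set a | exists k, s ^+ k * a = 0]).
  split; first by exists 0; rewrite mulr0.
    move=> a b [k ka] [k' kb]; exists (k + k')%N.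
    by rewrite mulrDr exprD mulrAC ka mul0r add0r -mulrA kb mulr0.
  by move=> c a [k ka]; exists k; rewrite mulrCA ka mulr0.
have [n nP] : exists n, forall a, a \in l -> s ^+ n * a = 0.
  have : forall a, a \in l -> exists k, s ^+ k * a = 0.
    by move=> a al; have : ideal_gen [set` l] a by [apply: ideal_gen_sub]; rewrite -lP.
  elim: (l) => [|a l' IHl] lz; first by exists 0.
  have [n nP] : exists n, forall b, b \in l' -> s ^+ n * b = 0.
    by apply: IHl => b bl; apply: lz; rewrite inE bl orbT.
  have [k ka] := lz a (mem_head _ _); exists (k + n)%N => b.
  rewrite inE exprD => /orP[/eqP ->|bl]; first by rewrite mulrAC ka mul0r.
  by rewrite -mulrA nP ?mulr0.
exists n => a k ka; have : ideal_gen [set` l] a by rewrite -lP; exists k.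
move: a {k ka}; apply: (@ideal_gen_min _ _ [set a | s ^+ n * a = 0]); last exact: nP.
split=> [|a b /= na nb|c a /= na]; first exact: mulr0.
  by rewrite mulrDr na nb addr0.
by rewrite mulrCA na mulr0.
Qed.

(* The localization of an injective module is a quotient of it: as the
   annihilators of the powers of [s] stabilize, [s^(n+1) a |-> s^n a e] is well
   defined for large [n], so [s] is surjective modulo torsion. *)
Lemma localize_exists : exists (Q : lmodType T) (l : E -> Q),
  [/\ forall s u v, l (s *: u + v) = f s *: l u + l v, is_onto l,
      forall e, l e = 0 <-> exists s, ~ p s /\ s *: e = 0 & ideal_injective Q].
Proof.
have [Q [l [l_onto l_ker]]] := quotient_exists torsion_sub.
have Qinj s (q : Q) : ~ p s -> s *: q = 0 -> q = 0.
  have [e <-] := l_onto q; move=> ps; rewrite -linearZ => /l_ker [t [pt te]].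
  by apply/l_ker; exists (t * s); split; [apply: pM | rewrite -scalerA].
have Qinj2 s (q q' : Q) : ~ p s -> s *: q = s *: q' -> q = q'.
  move=> ps e; apply/eqP; rewrite -subr_eq0; apply/eqP/(Qinj s) => //.
  by rewrite scalerBr e subrr.
have Qdiv s (q : Q) : ~ p s -> exists q', s *: q' = q.
  move=> ps; have [e <-] := l_onto q; have [n nP] := annihilators_stabilize s.
  pose I := [set b | exists a, b = s ^+ n.+1 * a].
  have /choice[h hP] : forall b, exists a, I b -> b = s ^+ n.+1 * a.
    by move=> b; have [[a ->]|nI] := pselect (I b); [exists a | exists 0].
  have I_ideal : is_ideal I.
    split; first by exists 0; rewrite mulr0.
      by move=> _ _ [a ->] [b ->]; exists (a + b); rewrite mulrDr.
    by move=> c _ [a ->]; exists (c * a); rewrite mulrCA.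
  have [|e' e'P] := E_inj I_ideal (h := fun b => (s ^+ n * h b) *: e).
    move=> c a b Ia Ib; rewrite scalerA -scalerDl; congr (_ *: _).
    have Ic : I (c * a + b) by case: I_ideal => _ ID IM; apply/ID/Ib/IM.
    apply/eqP; rewrite mulrCA -mulrDr -subr_eq0 -mulrBr; apply/eqP.
    by apply: (nP _ n.+1); rewrite mulrBr -(hP _ Ic) mulrDr mulrCA -!hP // subrr.
  exists (l e'); apply: (Qinj2 (s ^+ n)); first exact: pX.
  rewrite scalerA -exprSr -!linearZ /= -e'P; last by exists 1; rewrite mulr1.
  congr (l (_ *: e)); apply/eqP; rewrite -subr_eq0 -[X in _ - X]mulr1 -mulrBr.
  apply/eqP/(nP _ n.+1); rewrite mulrBr -hP; last by exists 1; rewrite mulr1.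
  by rewrite mulr1 subrr.
have [f_unit f_frac f_tors] := f_loc.
(* The graph of multiplication by [t], read off from any fraction [a / s] representing [t]. It is
   single-valued and total because every [s] outside [p] acts bijectively on [Q]. *)
pose R t (q q' : Q) := exists a s, [/\ ~ p s, f s * t = f a & s *: q' = a *: q].
have Rfun t q q1 q2 : R t q q1 -> R t q q2 -> q1 = q2.
  move=> [a [s [ps st sq]]] [b [s' [ps' st' sq']]].
  have [w [pw]] : exists w, ~ p w /\ w * (s' * a - s * b) = 0.
    by apply: f_tors; rewrite rmorphB !rmorphM -st -st' mulrCA subrr.
  rewrite mulrBr => /eqP; rewrite subr_eq0 => /eqP e.
  apply: (Qinj2 (w * (s' * s))); first by apply/pM/pM.
  transitivity ((w * (s' * a)) *: q); first by rewrite mulrA -scalerA sq scalerA mulrA.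
  by rewrite e [w * (s * b)]mulrA -[LHS]scalerA -sq' scalerA -mulrA [s * s']mulrC.
have /choice[sc scP] : forall tq : T * Q, exists q', R tq.1 tq.2 q'.
  move=> [t q] /=; have [a [s [ps st]]] := f_frac t.
  by have [q' q'E] := Qdiv s (a *: q) ps; exists q', a, s.
pose scale t q := sc (t, q).
have scaleP t q : R t q (scale t q) := scP (t, q).
have scaleE t q a s : ~ p s -> f s * t = f a -> s *: scale t q = a *: q.
  move=> ps st; have [q' q'E] := Qdiv s (a *: q) ps.
  by rewrite (Rfun _ _ _ _ (scaleP t q) (_ : R t q q')) //; exists a, s.
have scale_f a q : scale (f a) q = a *: q.
  by rewrite -[LHS]scale1r; apply: scaleE; rewrite ?rmorph1 ?mul1r.
have scaleA a b v : scale a (scale b v) = scale (a * b) v.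
  have [u [s [ps sa]]] := f_frac a; have [u' [s' [ps' sb]]] := f_frac b.
  apply: (Qinj2 (s * s')); first exact: pM.
  rewrite (@scaleE (a * b) v (u * u')); last 2 first.
  - exact: pM.
  - by rewrite !rmorphM mulrACA sa sb.
  rewrite [s * s']mulrC -[LHS]scalerA (scaleE _ _ _ _ ps sa) scalerA [s' * u]mulrC.
  by rewrite -[LHS]scalerA (scaleE _ _ _ _ ps' sb) scalerA.
have scale1 : left_id 1 scale by move=> q; rewrite -(rmorph1 f) scale_f scale1r.
have scaleDr : right_distributive scale +%R.
  move=> t u v; have [a [s [ps st]]] := f_frac t.
  by apply: (Qinj2 s) => //; rewrite scalerDr !(scaleE _ _ _ _ ps st) scalerDr.
have scaleDl v : {morph scale^~ v : a b / a + b}.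
  move=> a b; have [u [s [ps sa]]] := f_frac a; have [u' [s' [ps' sb]]] := f_frac b.
  apply: (Qinj2 (s * s')); first exact: pM.
  have psq : ~ p (s * s') by apply: pM.
  rewrite scalerDr (@scaleE _ _ (u * s' + u' * s) _ psq); last first.
    by rewrite rmorphD !rmorphM -sa -sb; ring.
  rewrite scalerDl -!scalerA (scaleE _ _ _ _ ps' sb) [s *: (s' *: _)]scalerA [s * s']mulrC.
  by rewrite -[(s' * s) *: _]scalerA (scaleE _ _ _ _ ps sa) !scalerA [s' * u]mulrC [s * u']mulrC.
pose QT : lmodType T := mklmod scaleA scale1 scaleDr scaleDl.
exists QT, l; split=> [s u v|q|e|].
- by rewrite -[RHS]/(scale (f s) (l u) + l v) scale_f linearP.
- exact: l_onto.
- exact: l_ker.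
move=> J h J_ideal hP; have [J0 JD JM] := J_ideal.
have h0 : h 0 = 0.
  have := hP 1 0 0 J0 J0; rewrite scale1r mul1r addr0; exact: add_self0.
have hZ c a : J a -> h (c * a) = c *: h a.
  by move=> Ja; have := hP c a 0 Ja J0; rewrite h0 !addr0.
have hS c a : J (f a) -> (h (f (c * a)) : Q) = c *: (h (f a) : Q).
  by move=> Ja; rewrite rmorphM hZ // -[LHS]/(scale (f c) (h (f a))) scale_f.
(* Injectivity over [T] is reduced to [S]. The contraction [I] of [J] is finitely presented, so
   lifts to [E] of the values of [h] at generators satisfy the finitely many relations after
   multiplication by one common [s] outside [p]. The lifts times [s] define a map from [I] to [E],
   and [s] is divided out again in [Q]. *)
pose I := [set a | J (f a)].
have I_ideal : is_ideal I.
  split; first by rewrite /I /= rmorph0.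
    by move=> a b Ia Ib; rewrite /I /= rmorphD; apply: JD.
  by move=> c a Ia; rewrite /I /= rmorphM; apply: JM.
have [gl glP] := S_noeth I_ideal; set m := size gl.
pose g : 'cV[S]_m := \col_i gl`_i.
have gI i : I (g i 0).
  by rewrite glP mxE; apply/ideal_gen_sub/mem_nth.
have hsum (c : 'rV[S]_m) : (h (f ((c *m g) 0 0)) : Q) = \sum_i c 0 i *: (h (f (g i 0)) : Q).
  rewrite [(c *m g) 0 0]mxE; suff : J (f (\sum_i c 0 i * g i 0)) /\
    (h (f (\sum_i c 0 i * g i 0)) : Q) = \sum_i c 0 i *: (h (f (g i 0)) : Q) by case.
  elim/big_ind2: _ => [|a u b v [Ja <-] [Jb <-]|i _].
  - by rewrite rmorph0 h0.
  - rewrite rmorphD; split; first exact: JD.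
    by have := hP 1 _ _ Ja Jb; rewrite mul1r scale1r.
  - by split; [rewrite rmorphM; apply/JM/gI | apply/hS/gI].
have /choice[e eP] : forall i, exists e, l e = h (f (g i 0)) by move=> i; apply: l_onto.
have [|r [B BP]] := @noetherian_rV S m [set c | c *m g = 0] S_noeth.
  split=> [|c d /= cg dg|c d /= dg]; first exact: mul0mx.
    by rewrite mulmxDl cg dg addr0.
  by rewrite -scalemxAl dg scaler0.
have Brel i : exists s, ~ p s /\ s *: (\sum_j B i j *: e j) = 0.
  apply/l_ker; rewrite linear_sum.
  transitivity (\sum_j row i B 0 j *: (h (f (g j 0)) : Q)).
    by apply: eq_bigr => j _; rewrite linearZ /= eP [row i B 0 j]mxE.
  rewrite -hsum; suff -> : row i B *m g = 0 by rewrite mxE rmorph0.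
  by apply/(BP (row i B)); exists (delta_mx 0 i); rewrite -rowE.
have [s [ps sB]] : exists s, ~ p s /\ forall i, s *: (\sum_j B i j *: e j) = 0.
  have /choice[s sP] := Brel; exists (\prod_i s i); split=> [|i].
    by elim/big_ind: _ => [|a b|i _]; [exact: p1 | exact: pM | case: (sP i)].
  rewrite (bigD1 i) //= mulrC -scalerA; case: (sP i) => _ ->; exact: scaler0.
have /choice[c cP] : forall b, exists c : 'rV[S]_m, I b -> b = (c *m g) 0 0.
  move=> b; have [Ib|nI] := pselect (I b); last by exists 0.
  by move: (Ib); rewrite glP => /ideal_genP [c cE]; exists c.
have crel (d : 'rV[S]_m) : d *m g = 0 -> s *: (\sum_j d 0 j *: e j) = 0.
  move=> /(BP d) [d' ->].
  transitivity (\sum_i d' 0 i *: (s *: (\sum_j B i j *: e j))); last first.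
    by apply: big1 => i _; rewrite sB scaler0.
  rewrite scaler_sumr; under [RHS]eq_bigr => i _ do rewrite scalerA scaler_sumr.
  rewrite exchange_big /=; apply: eq_bigr => j _; rewrite mxE scaler_suml scaler_sumr.
  by apply: eq_bigr => i _; rewrite !scalerA -mulrA mulrCA.
have [|e0 e0P] := E_inj I_ideal (h := fun b => s *: (\sum_j c b 0 j *: e j)).
  move=> d a b Ia Ib; apply/eqP; rewrite -subr_eq0; apply/eqP.
  have Icab : I (d * a + b) by case: I_ideal => _ ID IM; apply/ID/Ib/IM.
  have := crel (c (d * a + b) - (d *: c a + c b)).
  rewrite mulmxBl mulmxDl -scalemxAl => rel.
  rewrite scalerA [d * s]mulrC -scalerA -scalerDr -scalerBr -[RHS]rel.
    congr (s *: _); rewrite scaler_sumr -big_split -sumrB; apply: eq_bigr => j _ /=.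
    by rewrite !mxE scalerBl scalerDl scalerA.
  apply/matrixP => i j; rewrite !ord1 [LHS]mxE [X in _ + X]mxE [X in _ - X]mxE.
  by rewrite [X in _ - (X + _)]mxE -!cP // subrr mxE.
have [q qE] := Qdiv s (l e0) ps.
have hI a : I a -> h (f a) = a *: q.
  move=> Ia; apply: (Qinj2 s) => //; rewrite [RHS]scalerA mulrC -scalerA qE.
  rewrite -linearZ -e0P //= linearZ /= linear_sum {1}(cP _ Ia) hsum; congr (_ *: _).
  by apply: eq_bigr => j _; rewrite linearZ /= eP.
exists q => t Jt; have [a [r' [pr' rt]]] := f_frac t.
have Ia : I a by rewrite /I /= -rt; apply: JM.
apply: (Qinj2 r') => //; rewrite -[RHS]/(r' *: scale t q) (scaleE _ _ _ _ pr' rt).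
by rewrite -hI // -rt hZ // -[RHS]/(scale (f r') (h t)) scale_f.
Qed.
End Localization.

(** * Frobenius extensions of [k[X]] are Gorenstein *)

(** A nonzero ideal is generated by a nonzero element [g] of least size, by Euclidean division, and
    [e] is obtained by dividing [h g] by [g] in [E]. *)
Lemma divisible_ideal_injective (k : fieldType) (E : lmodType {poly k}) :
  (forall (a : {poly k}) (e : E), a != 0 -> exists e', a *: e' = e) ->
  ideal_injective E.
Proof.
move=> Ediv I h [I0 ID IM] hP.
have h0 : h 0 = 0.
  have := hP 1 0 0 I0 I0; rewrite scale1r mul1r addr0; exact: add_self0.
have [[g0 [Ig0 g0n]]|no] := pselect (exists g, I g /\ g != 0); last first.
  exists 0 => a Ia; have [->|an] := eqVneq a 0; first by rewrite h0 scaler0.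
  by case: no; exists a.
have ex : exists n, `[< exists g, [/\ I g, g != 0 & size g = n] >].
  by exists (size g0); apply/asboolP; exists g0.
case: (ex_minnP ex) => n /asboolP [g [Ig gn sg]] gmin.
have [e eE] := Ediv g (h g) gn; exists e => a Ia.
have ->: a = (a %/ g) * g.
  rewrite {1}(divp_eq a g); have [->|rn] := eqVneq (a %% g) 0; first by rewrite addr0.
  have Ir : I (a %% g).
    suff -> : a %% g = a + (- (a %/ g)) * g by apply/ID/IM.
    by rewrite {2}(divp_eq a g) mulNr addrAC subrr add0r.
  have : (n <= size (a %% g)%R)%N by apply: gmin; apply/asboolP; exists (a %% g).
  by rewrite leqNgt -sg ltn_modp gn.
have := hP (a %/ g) g 0 Ig I0; rewrite h0 !addr0 => ->.
by rewrite -eE scalerA.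
Qed.

Lemma max_ideal_prime (S : comNzRingType) (m : set S) (a b : S) :
  max_ideal m -> ~ m a -> ~ m b -> ~ m (a * b).
Proof.
move=> [[m0 mD mM] m1 mmax] ma mb mab.
pose I := [set s | exists c t, m c /\ s = c + t * a].
have I_ideal : is_ideal I.
  split; first by exists 0, 0; rewrite mul0r addr0.
    move=> _ _ [c [t [mc ->]]] [c' [t' [mc' ->]]]; exists (c + c'), (t + t').
    by split; [apply: mD | rewrite mulrDl addrACA].
  move=> d _ [c [t [mc ->]]]; exists (d * c), (d * t).
  by split; [apply: mM | rewrite mulrDr mulrA].
have [[c [t [mc e]]]|I1] := pselect (I 1).
  apply: mb; rewrite -[b]mul1r e mulrDl -mulrA [c * b]mulrC.
  by apply: mD; apply: mM.
apply: ma; apply: (mmax I I_ideal I1) => [s ms|]; last first.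
  by exists 0, 1; rewrite add0r mul1r.
by exists s, 0; rewrite mul0r addr0.
Qed.

Section Frobenius.
Variables (k : fieldType) (S : comNzRingType) (psi : {rmorphism {poly k} -> S}).
Let Alinear (E : lmodType {poly k}) (g : S -> E) :=
  forall c s t, g (psi c * s + t) = c *: g s + g t.
Variable lam : S -> {poly k}.
Hypothesis lamP : forall c s t, lam (psi c * s + t) = c * lam s + lam t.
Hypothesis lam_perfect : forall g : S -> {poly k},
  (forall c s t, g (psi c * s + t) = c * g s + g t) ->
  exists s, forall t, g t = lam (s * t).
Hypothesis lam_nondeg : forall s, (forall t, lam (s * t) = 0) -> s = 0.
Variables (n : nat) (b : 'I_n -> S) (coord : 'I_n -> S -> {poly k}).
Hypothesis coordP : forall i c s t,
  coord i (psi c * s + t) = c * coord i s + coord i t.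
Hypothesis coordE : forall s, s = \sum_i psi (coord i s) * b i.

Let F : zmodType := {fraction {poly k}}.
Let fscale (a : {poly k}) (v : F) : F := (tofrac a * (v : {fraction {poly k}}))%R.
Let fscaleA a c v : fscale a (fscale c v) = fscale (a * c) v.
Proof. by rewrite /fscale mulrA tofracM. Qed.
Let fscale1 : left_id 1 fscale.
Proof. by move=> v; rewrite /fscale tofrac1 mul1r. Qed.
Let fscaleDr : right_distributive fscale +%R.
Proof. by move=> a u v; rewrite /fscale mulrDr. Qed.
Let fscaleDl v : {morph fscale^~ v : a c / a + c}.
Proof. by move=> a c; rewrite /fscale tofracD mulrDl. Qed.
Let FA : lmodType {poly k} := mklmod fscaleA fscale1 fscaleDr fscaleDl.

Let FA_div (a : {poly k}) (e : FA) : a != 0 -> exists e', a *: e' = e.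
Proof.
move=> an; exists ((tofrac a)^-1 * (e : {fraction {poly k}}) : FA).
by rewrite -[LHS]/(tofrac a * (_ * _)) mulrA divff ?mul1r // tofrac_eq0.
Qed.

Let poly_sub : submodule [set v : FA | exists a : {poly k}, v = tofrac a].
Proof.
split; first by exists 0; rewrite tofrac0.
  by move=> _ _ [a ->] [c ->]; exists (a + c); rewrite tofracD.
by move=> c _ [a ->]; exists (c * a); rewrite tofracM.
Qed.

(* With [A = k[X]], localize
   [0 -> S -> Hom_A(S, Frac A) -> Hom_A(S, Frac A / A) -> 0]. *)
Lemma frobenius_gorenstein : noetherian S -> gorenstein S.
Proof.
move=> S_noeth; split=> // m T f m_max f_loc.
have [_ m1 _] := m_max; have mM a c := @max_ideal_prime S m a c m_max.
have [f_unit f_frac f_tors] := f_loc.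
have [G [pr [pr_onto pr_ker]]] := quotient_exists poly_sub.
have [H0 [ev0 [ev0P ev0_ext ev0_lin ev0_onto /(_ (divisible_ideal_injective FA_div)) H0_inj]]] :=
  coinduced_exists psi FA.
have G_div (a : {poly k}) (e : G) : a != 0 -> exists e', a *: e' = e.
  move=> an; have [v <-] := pr_onto e; have [w wE] := FA_div v an.
  by exists (pr w); rewrite -linearZ wE.
have [H1 [ev1 [ev1P ev1_ext ev1_lin ev1_onto /(_ (divisible_ideal_injective G_div)) H1_inj]]] :=
  coinduced_exists psi G.
have /choice[P PE] : forall h, exists h1, ev1 h1 = pr \o ev0 h.
  by move=> h; apply: ev1_onto => c s t /=; rewrite ev0P linearP.
have P_lin c h h' : P (c *: h + h') = c *: P h + P h'.
  apply: ev1_ext => s; rewrite ev1_lin !PE /= ev0_lin linearD.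
  by [].
(* [j1] is [lam] with values in the fraction field. The map [a |-> a j1] embeds [S], and as [lam] is
   perfect its image consists of the functionals with polynomial values, that is, of the kernel of
   [P]. *)
have [j1 j1E] : exists j1, ev0 j1 = (fun s => tofrac (lam s) : FA).
  by apply: ev0_onto => c s t; rewrite lamP tofracD tofracM.
have j1Z a s : ev0 (a *: j1) s = tofrac (lam (a * s)).
  have ev0z : ev0 (0 : H0) s = 0.
    have := ev0_lin 1 0 0 s; rewrite scaler0 add0r mul1r; exact: add_self0.
  by have := ev0_lin a j1 0 s; rewrite addr0 ev0z addr0 j1E.
have P_onto h1 : exists h, P h = h1.
  have /choice[w wE] : forall i, exists w, pr w = ev1 h1 (b i) by move=> i; apply: pr_onto.
  have [h hE] : exists h, ev0 h = (fun s => \sum_i coord i s *: w i).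
    apply: ev0_onto => c s t; rewrite scaler_sumr -big_split; apply: eq_bigr => i _.
    by rewrite coordP scalerDl scalerA.
  have ev1_sum (I : seq 'I_n) (c : 'I_n -> {poly k}) :
      ev1 h1 (\sum_(i <- I) psi (c i) * b i) = \sum_(i <- I) c i *: ev1 h1 (b i).
    elim: I => [|i I IH]; last by rewrite !big_cons ev1P IH.
    rewrite !big_nil; have := ev1P h1 1 0 0.
    rewrite mulr0 addr0 scale1r; exact: add_self0.
  exists h; apply: ev1_ext => s; rewrite PE /= hE linear_sum [in RHS](coordE s) ev1_sum.
  by apply: eq_bigr => i _; rewrite linearZ /= wE.
have P_ker h : P h = 0 -> exists a, h = a *: j1.
  move=> Ph; have : forall s, exists a : {poly k}, ev0 h s = tofrac a.
    move=> s; apply/pr_ker; have := congr1 (fun h1 => ev1 h1 s) Ph.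
    rewrite PE /= => ->; have := ev1_lin 1 0 0 s.
    rewrite scaler0 add0r mul1r; exact: add_self0.
  move=> /choice[g gE]; have [|a aE] := lam_perfect (g := g).
    move=> c s t; apply/eqP; rewrite -tofrac_eq tofracD tofracM -!gE; apply/eqP.
    exact: ev0P.
  by exists a; apply: ev0_ext => s; rewrite j1Z gE aE.
have Pj1 : P j1 = 0.
  apply: ev1_ext => s; rewrite PE /= j1E.
  have -> : pr (tofrac (lam s) : FA) = 0 by apply/pr_ker; exists (lam s).
  by apply: esym; have := ev1_lin 1 0 0 s; rewrite scaler0 add0r mul1r; exact: add_self0.
have [Q0 [l0 [l0P l0_onto l0_ker Q0_inj]]] := localize_exists S_noeth m1 mM f_loc H0_inj.
have [Q1 [l1 [l1P l1_onto l1_ker Q1_inj]]] := localize_exists S_noeth m1 mM f_loc H1_inj.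
have [r0 r0K] := choice l0_onto.
have l0_0 : l0 0 = 0 by apply/l0_ker; exists 1; rewrite scaler0.
have l1_0 : l1 0 = 0 by apply/l1_ker; exists 1; rewrite scaler0.
have P0 : P 0 = 0.
  have := P_lin 1 0 0; rewrite scaler0 add0r scale1r; exact: add_self0.
have l0Z s u : l0 (s *: u) = f s *: l0 u by have := l0P s u 0; rewrite l0_0 !addr0.
have l1Z s u : l1 (s *: u) = f s *: l1 u by have := l1P s u 0; rewrite l1_0 !addr0.
have PZ s u : P (s *: u) = s *: P u by have := P_lin s u 0; rewrite P0 !addr0.
have l0D u v : l0 (u + v) = l0 u + l0 v.
  by have := l0P 1 u v; rewrite rmorph1 !scale1r.
have l1D u v : l1 (u + v) = l1 u + l1 v.
  by have := l1P 1 u v; rewrite rmorph1 !scale1r.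
have PD u v : P (u + v) = P u + P v by have := P_lin 1 u v; rewrite !scale1r.
pose Ph q := l1 (P (r0 q)).
have PhE h : Ph (l0 h) = l1 (P h).
  have [s [ps sE]] : exists s, ~ m s /\ s *: (r0 (l0 h) - h) = 0.
    by apply/l0_ker; rewrite -scaleN1r l0D l0Z r0K rmorphN1 scaleN1r subrr.
  apply/eqP; rewrite -subr_eq0; apply/eqP.
  suff <- : l1 (P (r0 (l0 h) - h)) = l1 (P (r0 (l0 h))) - l1 (P h).
    by apply/l1_ker; exists s; rewrite -PZ sE P0.
  by rewrite -scaleN1r PD PZ l1D l1Z rmorphN1 scaleN1r.
have PhD u v : Ph (u + v) = Ph u + Ph v.
  by rewrite -(r0K u) -(r0K v) -l0D !PhE PD l1D.
have PhS s u : Ph (f s *: u) = f s *: Ph u.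
  by rewrite -(r0K u) -l0Z !PhE PZ l1Z.
have f_inj (Q : lmodType T) s (u v : Q) : ~ m s -> f s *: u = f s *: v -> u = v.
  move=> ms e; have [t st] := f_unit s ms.
  by rewrite -[u]scale1r -[v]scale1r -st mulrC -!scalerA e.
have PhL : linear Ph.
  move=> t u v; rewrite PhD; congr (_ + _); have [a [s [ms st]]] := f_frac t.
  by apply: (f_inj _ s) => //; rewrite -PhS !scalerA st PhS.
have JL : linear (fun t : T^o => (t : T) *: l0 j1).
  by move=> c u v; rewrite scalerDl scalerA.
(* The resolution has length one; rows of length [0] supply the zero modules beyond. *)
pose E i : lmodType T := match i with 0 => Q0 | 1 => Q1 | _ => 'rV[T]_0 end.
have nullL (U V : lmodType T) : linear (fun _ : U => 0 : V).
  by move=> c u v; rewrite scaler0 addr0.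
pose D i : {linear E i -> E i.+1} :=
  match i with 0 => mklin PhL | _ => mklin (nullL _ _) end.
exists 1, E, (mklin JL), D; split.
- by case=> [|[|i]]; [exact: ideal_injectiveP | exact: ideal_injectiveP |
    move=> A B j _ g; exists (mklin (nullL _ _)) => a; rewrite [LHS]thinmx0 [RHS]thinmx0].
- move=> u v /= e; suff : (u - v : T) = 0 by move=> /eqP; rewrite subr_eq0 => /eqP.
  have : (u - v : T) *: l0 j1 = 0 by rewrite scalerBl e subrr.
  have [a [s [ms st]]] := f_frac (u - v).
  move=> /(congr1 (fun q => f s *: q)); rewrite scaler0 scalerA st -l0Z => /l0_ker.
  move=> [s' [ms']]; rewrite scalerA => /(congr1 ev0) sa.
  have sa0 : s' * a = 0.
    apply: lam_nondeg => t; apply/eqP; rewrite -tofrac_eq0 -j1Z sa; apply/eqP.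
    have := ev0_lin 1 0 0 t; rewrite scaler0 add0r mul1r; exact: add_self0.
  have [t tE] := f_unit _ ms; have [t' t'E] := f_unit _ ms'.
  rewrite -[u - v]mul1r -tE mulrAC st -[f a]mul1r -t'E -mulrA [t' * _]mulrC mulrA.
  by rewrite -rmorphM sa0 rmorph0 !mul0r.
- move=> q; split=> [|[t <-]] /=; last first.
    have [a [s [ms st]]] := f_frac t; apply: (f_inj _ s) => //.
    by rewrite -PhS scalerA st PhS PhE Pj1 l1_0 !scaler0.
  rewrite -{1}(r0K q) PhE => /l1_ker [s [ms]]; rewrite -PZ => /P_ker [a aE].
  have [t tE] := f_unit s ms; exists (t * f a).
  apply: (f_inj _ s) => //; rewrite scalerA mulrA tE mul1r -l0Z -aE l0Z.
  by rewrite r0K.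
- case=> [|i] v; last by split=> // _; exists 0; rewrite [RHS]thinmx0 [LHS]thinmx0.
  split=> // _; have [h1 <-] := l1_onto v; have [h <-] := P_onto h1.
  by exists (l0 h); rewrite /= PhE.
- by case=> [|[|i]] // v _; rewrite [LHS]thinmx0 [RHS]thinmx0.
Qed.

End Frobenius.

(** * Homogeneous rings of dimension one *)

Section Graded.
Variables (k : fieldType) (r : nat) (S : comNzRingType).
Variable phi : {rmorphism {mpoly k[r]} -> S}.
Hypothesis S_homogeneous : homogeneous_presentation phi.

Definition scalar_map : {rmorphism k -> S} := phi \o @mpolyC r k.
Local Notation iota := scalar_map.

(** The substitution [X_i |-> phi(X_i) T] records degrees as exponents of [T]. It kills every
    homogeneous polynomial in the kernel of [phi], so it descends to [S] because that kernel has
    homogeneous generators. *)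
Let Phi : {rmorphism {mpoly k[r]} -> {poly S}} :=
  mmap (polyC \o iota) (fun i : 'I_r => phi 'X_i *: 'X).

Let PhiX m : Phi 'X_[m] = phi 'X_[m] *: 'X^(mdeg m).
Proof.
rewrite /Phi /= mmapX /mmap1 mdegE [in RHS]mpolyXE_id rmorph_prod -mul_polyC.
rewrite rmorph_prod -prodrXr -big_split /=; apply: eq_bigr => i _.
by rewrite exprZn rmorphXn /= -mul_polyC.
Qed.

Let PhiE p : Phi p = \sum_(m <- msupp p) phi (p@_m *: 'X_[m]) *: 'X^(mdeg m).
Proof.
rewrite {1}(mpolyE p) rmorph_sum; apply: eq_bigr => m _ /=.
by rewrite -mul_mpolyC rmorphM PhiX /= mmapC /= mul_polyC scalerA rmorphM.
Qed.

Let Phi_homog p d : p \is d.-homog -> Phi p = phi p *: 'X^d.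
Proof.
move=> /dhomogP pd; rewrite PhiE [in RHS](mpolyE p) rmorph_sum scaler_suml.
by rewrite !big_seq; apply: eq_bigr => m /pd ->.
Qed.

Let Phi_horner p : (Phi p).[1] = phi p.
Proof.
rewrite PhiE horner_sum [in RHS](mpolyE p) rmorph_sum; apply: eq_bigr => m _ /=.
by rewrite hornerZ hornerXn expr1n mulr1.
Qed.

Let Phi_coef p d : exists q, q \is d.-homog /\ (Phi p)`_d = phi q.
Proof.
exists (pihomog mdeg d p); split; first exact: pihomogP.
rewrite PhiE coef_sum pihomogE rmorph_sum /= [RHS]big_mkcond /=.
apply: eq_bigr => m _; rewrite coefZ coefXn eq_sym.
by case: eqP; rewrite ?mulr1 ?mulr0.
Qed.

(* [tau s] lists the homogeneous components of [s]. *)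
Lemma grading_exists : exists tau : {rmorphism S -> {poly S}},
  [/\ forall s, (tau s).[1] = s,
      forall p d, p \is d.-homog -> tau (phi p) = phi p *: 'X^d &
      forall s d, exists p, p \is d.-homog /\ (tau s)`_d = phi p].
Proof.
have [phi_onto [G [G_homog G_ker]]] := S_homogeneous.
have Phi0 p : phi p = 0 -> Phi p = 0.
  move/G_ker => [n [c [g [Gg ->]]]]; rewrite rmorph_sum big1 // => i _.
  have [d gd] := G_homog _ (Gg i); rewrite rmorphM (Phi_homog gd).
  have -> : phi (g i) = 0 by apply/G_ker/ideal_gen_sub.
  by rewrite scale0r mulr0.
have [s sK] := choice phi_onto.
pose tau := Phi \o s.
have tauE p : tau (phi p) = Phi p.
  apply/eqP; rewrite -subr_eq0 -rmorphB; apply/eqP/Phi0.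
  by rewrite rmorphB sK subrr.
have tauB : zmod_morphism tau.
  by move=> a b; rewrite -(sK a) -(sK b) -rmorphB !tauE rmorphB.
have tauM : monoid_morphism tau.
  split; first by rewrite -(rmorph1 phi) tauE rmorph1.
  by move=> a b; rewrite -(sK a) -(sK b) -rmorphM !tauE rmorphM.
pose tauR : {rmorphism S -> {poly S}} := HB.pack tau
  (GRing.isZmodMorphism.Build _ _ tau tauB) (GRing.isMonoidMorphism.Build _ _ tau tauM).
exists tauR; split=> [a|p d pd|a d] /=.
- by rewrite -(sK a) tauE Phi_horner.
- by rewrite tauE (Phi_homog pd).
- exact: Phi_coef.
Qed.

End Graded.

Section GradedRing.
Variables (k : fieldType) (r : nat) (S : comNzRingType).
Variable phi : {rmorphism {mpoly k[r]} -> S}.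
Variable tau : {rmorphism S -> {poly S}}.
Hypothesis tau_horner : forall s, (tau s).[1] = s.
Hypothesis tau_homog : forall p d, p \is d.-homog -> tau (phi p) = phi p *: 'X^d.
Hypothesis tau_coef : forall s d, exists p, p \is d.-homog /\ (tau s)`_d = phi p.
Local Notation iota := (scalar_map phi).
Local Notation n := (graded_max_ideal phi).

Let tau_iota c : tau (iota c) = (iota c)%:P.
Proof.
by rewrite /= (@tau_homog _ 0) ?expr0 ?alg_polyC // -[c%:MP]mulr1 mul_mpolyC dhomogZ ?dhomog1.
Qed.

Let tau_comp s d : tau (tau s)`_d = (tau s)`_d *: 'X^d.
Proof. by have [p [pd ->]] := tau_coef s d; apply: tau_homog. Qed.

Let tau_inj s : tau s = 0 -> s = 0.
Proof. by move=> ts; rewrite -(tau_horner s) ts horner0. Qed.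

Let sum_comp s : s = \sum_(i < size (tau s)) (tau s)`_i.
Proof.
rewrite -{1}(tau_horner s) horner_coef; apply: eq_bigr => i _.
by rewrite expr1n mulr1.
Qed.

Lemma graded_max_idealP s : n s <-> (tau s)`_0 = 0.
Proof.
split.
  apply: (@ideal_gen_min _ _ [set s | (tau s)`_0 = 0]).
    split=> [|a b /= a0 b0|c a /= a0] /=; first by rewrite rmorph0 coef0.
      by rewrite rmorphD coefD a0 b0 addr0.
    by rewrite rmorphM coef0M a0 mulr0.
  move=> _ [d [p [d0 pd ->]]] /=; rewrite (tau_homog pd) coefZ coefXn.
  by case: d d0 {pd} => // d _; rewrite mulr0.
move=> s0; have [N0 ND NM] := ideal_gen_ideal [set s | exists d p,
    [/\ (0 < d)%N, p \is d.-homog & s = phi p]].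
rewrite (sum_comp s); elim/big_ind: _ => // -[[|i] i_lt] _ /=; first by rewrite s0.
apply: ideal_gen_sub; have [p [pd ->]] := tau_coef s i.+1.
by exists i.+1, p.
Qed.

Lemma scalar_decomposition s : exists c, n (s - iota c).
Proof.
have [p [pd pE]] := tau_coef s 0; exists p@_0%MM; apply/graded_max_idealP.
rewrite rmorphB coefB tau_iota coefC /= pE; apply/eqP; rewrite subr_eq0.
suff {1}-> : p = (p@_0%MM)%:MP by [].
apply/mpolyP => m; rewrite mcoeffC; case: eqP => [<-|m0]; first by rewrite mulr1.
rewrite mulr0; apply: (dhomog_nemf_coeff pd); rewrite mdeg_eq0.
by apply/eqP => e; apply: m0.
Qed.

Let tau0_scalar s : exists c, (tau s)`_0 = iota c.
Proof.
have [c /graded_max_idealP] := scalar_decomposition s; rewrite rmorphB coefB tau_iota.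
by rewrite coefC /= => /eqP; rewrite subr_eq0 => /eqP e; exists c.
Qed.

Lemma graded_max_ideal_ideal : is_ideal n.
Proof. exact: ideal_gen_ideal. Qed.

Lemma scalar_unit c : c != 0 -> iota c * iota c^-1 = 1.
Proof. by move=> cn; rewrite -rmorphM divff // rmorph1. Qed.

Lemma graded_max_ideal_proper : ~ n 1.
Proof. by move=> /graded_max_idealP; rewrite rmorph1 coef1 => /eqP; rewrite oner_eq0. Qed.

Lemma graded_max_ideal_max : max_ideal n.
Proof.
split; [exact: graded_max_ideal_ideal | exact: graded_max_ideal_proper |].
move=> I [I0 ID IM] I1 nI a Ia; have [c nac] := scalar_decomposition a.
have [c0|cn] := eqVneq c 0; first by rewrite -[a]subr0 -(rmorph0 iota) -c0.
case: I1; rewrite -(scalar_unit cn) mulrC; apply/IM.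
have -> : iota c = a + (-1) * (a - iota c) by ring.
by apply/ID/IM/nI.
Qed.

(** The degree-zero component of [s] is a nonzero scalar, so the components of [t] vanish one after
    another. Factors outside [n] can thus be cancelled without localizing. *)
Lemma graded_nilpotent s t : ~ n s -> s * t = 0 -> t = 0.
Proof.
move=> ns st; have [c c0] := tau0_scalar s.
have cn : c != 0.
  by apply: contra_notN ns => /eqP e; apply/graded_max_idealP; rewrite c0 e rmorph0.
apply/tau_inj/polyP => i; rewrite coef0; elim/ltn_ind: i => i IH.
have := congr1 (fun q : {poly S} => q`_i) (congr1 tau st).
rewrite rmorphM rmorph0 coef0 coefM big_ord_recl /= subn0 c0 big1 ?addr0.
  by move=> e; rewrite -[LHS]mul1r -(scalar_unit cn) mulrAC e mul0r.
by move=> j _; rewrite IH ?mulr0 //= ltn_subrL /= (leq_ltn_trans _ (ltn_ord j)).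
Qed.

Variable x : S.
Hypothesis S_dim1 : krull_dim S 1.
Hypothesis S_CM : cohen_macaulay S.
Hypothesis x_red : minimal_reduction n x.

Lemma red_mul a b : n a -> n b -> exists c, n c /\ a * b = x * c.
Proof.
move=> na nb; have [_ e] := x_red.
have : ideal_mul n n (a * b) by apply: ideal_gen_sub; exists a, b.
by rewrite -e => -[c nc <-]; exists c.
Qed.

(* Otherwise [x] is nilpotent, and every prime contains [n]. *)
Lemma not_height0 : ~ height n 0.
Proof.
move=> [_ noP]; have [N0 ND NM] := graded_max_ideal_ideal.
(* An ideal maximal among those avoiding the multiplicative set [W] is prime, lies inside [n] and
   misses [x]; it would give a chain of length one below [n]. *)
pose W := [set w | exists s N, ~ n s /\ w = s * x ^+ N].
have nM a b : ~ n a -> ~ n b -> ~ n (a * b) := max_ideal_prime graded_max_ideal_max.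
have WM a b : W a -> W b -> W (a * b).
  move=> [s [N [ns ->]]] [t [N' [nt ->]]]; exists (s * t), (N + N')%N.
  by split; [apply: nM | rewrite exprD mulrACA].
have W1 : W 1 by exists 1, 0; split; [exact: graded_max_ideal_proper | rewrite expr0 mulr1].
have [[s [N [ns /esym sx]]]|W0] := pselect (W 0).
  have xN : x ^+ N = 0 by apply: graded_nilpotent sx.
  have [[P [Pprime Pstrict]] _] := S_dim1.
  have sub Q : prime_ideal Q -> n `<=` Q.
    move=> [[Q0 QD QM] Q1 Qprime] a na.
    have Qx : Q x.
      have : Q (x ^+ N) by rewrite xN.
      elim: (N) => [|m IH]; first by rewrite expr0 => /Q1.
      by rewrite exprS => /Qprime [].
    have [c [_ e]] := red_mul na na.
    have : Q (a * a) by rewrite e mulrC; apply: QM.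
    by move=> /Qprime [].
  have [_ P1n] := Pstrict 0 isT; apply: P1n => a P1a; apply: (sub _ (Pprime 0 isT)).
  have [_ _ nmax] := graded_max_ideal_max; have [I1 I11 _] := Pprime 1 isT.
  exact: (nmax _ I1 I11 (sub _ (Pprime 1 isT))).
(* Adjoining [0] admits the empty chain in Zorn's lemma. *)
have [F F_tot|I [[I_ideal IW] Imax]] := @Zorn_bigcup S
    (fun I => is_ideal (I `|` [set 0]) /\ forall w, W w -> ~ (I `|` [set 0]) w).
  move=> FP; split.
    split; first by right.
      move=> a b; case=> [[I FI Ia]|->]; last by rewrite add0r.
      case=> [[J FJ Jb]|->]; last by rewrite addr0; left; exists I.
      have key K : F K -> K a -> K b -> (\bigcup_(X in F) X `|` [set 0]) (a + b).
        move=> FK Ka Kb; have [[_ KD _] _] := F_tot _ FK.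
        by case: (KD a b (or_introl Ka) (or_introl Kb)) => [Kab|->]; [left; exists K | right].
      have [IJ|JI] := FP _ _ FI FJ; first by apply: (key J) => //; apply: IJ.
      by apply: (key I) => //; apply: JI.
    move=> c a; case=> [[I FI Ia]|->]; last by rewrite mulr0; right.
    have [[_ _ IM] _] := F_tot _ FI.
    by case: (IM c a (or_introl Ia)) => [Ica|->]; [left; exists I | right].
  move=> w Ww; case=> [[I FI Iw]|w0]; last by apply: W0; rewrite -w0.
  by have [_ /(_ w Ww)] := F_tot _ FI; apply; left.
have I0 : I 0.
  apply: contrapT => nI0; apply: (Imax (I `|` [set 0])).
    by split; [left | move=> /(_ 0 (or_intror erefl))].
  by rewrite -setUA setUid.
have sub0 (J : set S) : J 0 -> J `|` [set 0] = J.
  by move=> J0; apply/seteqP; split=> a; [case=> // -> | left].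
rewrite (sub0 I) // in I_ideal IW; have [_ ID IM] := I_ideal.
have adj a : ~ I a -> exists w i t, [/\ W w, I i & w = i + t * a].
  move=> nIa; pose J := [set u | exists i t, I i /\ u = i + t * a].
  have J0 : J 0 by exists 0, 0; rewrite mul0r addr0.
  apply: contrapT => no; apply: (Imax J).
    split; first by move=> i Ii; exists i, 0; rewrite mul0r addr0.
    by move=> JI; apply: nIa; apply: JI; exists 0, 1; rewrite add0r mul1r.
  rewrite (sub0 J) //; split=> [|w Ww [i [t [Ii e]]]]; last by apply: no; exists w, i, t.
  split=> //.
    move=> _ _ [i [t [Ii ->]]] [i' [t' [Ii' ->]]]; exists (i + i'), (t + t').
    by split; [apply: ID | rewrite mulrDl addrACA].
  move=> c _ [i [t [Ii ->]]]; exists (c * i), (c * t).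
  by split; [apply: IM | rewrite mulrDr mulrA].
have I_prime : prime_ideal I.
  split=> //; first exact: IW.
  move=> a b Iab; apply: contrapT => /not_orP [].
  move=> /adj [w [i [t [Ww Ii wE]]]] /adj [v [j [u [Wv Ij vE]]]].
  apply: (IW _ (WM _ _ Ww Wv)); rewrite wE vE.
  have -> : (i + t * a) * (j + u * b) = (j + u * b) * i + (t * a * j + (t * u) * (a * b)) by ring.
  by apply: (ID); [apply: (IM) | apply: (ID); apply: (IM)].
have In : I `<=` n.
  by move=> a Ia; apply: contrapT => na; apply: (IW a) => //; exists a, 0; rewrite expr0 mulr1.
apply: noP; exists (fun i => if i is 0 then I else n) => //; split.
  case=> [|[|i]] // _; split; [exact: graded_max_ideal_ideal | exact: graded_max_ideal_proper |].
  move=> a b nab; apply: contrapT => /not_orP [na nb].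
  exact: nM nab.
case=> // _; split=> // nI; have [nx _] := x_red.
apply: (IW x); last exact: nI.
by exists 1, 1; split; [exact: graded_max_ideal_proper | rewrite expr1 mul1r].
Qed.

(** Grade equals height at [n] and is not [0], so [n] contains a regular element [s]. Its square
    lies in [x n], so whatever [x] kills is killed by [s^2]. *)
Lemma reduction_regular a : x * a = 0 -> a = 0.
Proof.
move=> xa; have [_ /(_ _ graded_max_ideal_max) [d [dh [[s [[s_reg _] sd s_n]] _]]]] := S_CM.
case: d => [|d] in dh sd *; first by case: not_height0.
have sn : (0 < size s)%N by rewrite sd.
have reg0 b : s`_0 * b = 0 -> b = 0.
  move=> sb; have := s_reg 0 b sn; rewrite take0 => reg.
  have nil0 u : ideal_gen [set` [::]] u -> u = 0.
    by move=> /ideal_genP [c ->]; rewrite mxE big_ord0.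
  by apply: nil0; apply: reg; rewrite sb; case: (@ideal_gen_ideal S [set` [::]]).
have ns : n s`_0 by apply: s_n; apply: mem_nth.
have [c [_ e]] := red_mul ns ns.
by apply/reg0/reg0; rewrite mulrA e mulrAC xa mul0r.
Qed.


(** * The case [n = x S + k y] *)

Section TwoGenerated.
Variable y : S.
Hypothesis n_gen : forall a, n a -> exists t c, a = x * t + iota c * y.
Local Notation x1 := (tau x)`_1.
Local Notation y1 := (tau y)`_1.

(** The whole degree-one part of [S], by [homog1_n] and [homog1P]. As [x] and [y] may be
    inhomogeneous, their linear parts take over. *)
Let homog1 (a : S) := exists c d, a = iota c * x1 + iota d * y1.

Let nx : n x. Proof. by case: x_red. Qed.

Let homog1_n a : homog1 a -> n a /\ tau a = a *: 'X.
Proof.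
move=> [c [d ->]]; have tauE : tau (iota c * x1 + iota d * y1) = (iota c * x1 + iota d * y1) *: 'X.
  by rewrite rmorphD !rmorphM !tau_iota !tau_comp expr1 !mul_polyC !scalerA scalerDl.
by split=> //; apply/graded_max_idealP; rewrite tauE coefZ coefX mulr0.
Qed.

Let homog1P a : n a -> tau a = a *: 'X -> homog1 a.
Proof.
move=> /n_gen [t [c e]] ta; have [d d0] := tau0_scalar t.
exists d, c; have := congr1 (fun q : {poly S} => q`_1) ta.
rewrite coefZ coefX mulr1 => <-; rewrite e rmorphD !rmorphM tau_iota coefD coefCM.
rewrite coefM !big_ord_recl big_ord0 /= (proj1 (graded_max_idealP x) nx) mul0r add0r addr0.
by rewrite /bump /= subnn d0 mulrC.
Qed.

Let homog1D a b : homog1 a -> homog1 b -> homog1 (a + b).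
Proof.
move=> [c [d ->]] [c' [d' ->]]; exists (c + c'), (d + d').
by rewrite !rmorphD !mulrDl addrACA.
Qed.

Let homog1Z c a : homog1 a -> homog1 (iota c * a).
Proof.
by move=> [d [d' ->]]; exists (c * d), (c * d'); rewrite !rmorphM mulrDr !mulrA.
Qed.

(** Compare degree-two components in [a b = x c]: neither [x] nor [c] has a constant term, so only
    their linear parts contribute. *)
Let homog1M a b : homog1 a -> homog1 b -> exists c, homog1 c /\ a * b = x1 * c.
Proof.
move=> /homog1_n [na ta] /homog1_n [nb tb]; have [c [nc e]] := red_mul na nb.
exists (tau c)`_1; split.
  apply: homog1P; last by rewrite tau_comp expr1.
  by apply/graded_max_idealP; rewrite tau_comp expr1 coefZ coefX mulr0.
have := congr1 (fun q : {poly S} => q`_2) (congr1 tau e).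
rewrite !rmorphM ta tb -scalerAl -scalerAr scalerA coefZ -expr2 coefXn mulr1 => ->.
rewrite coefM !big_ord_recl big_ord0 /= /bump /=.
rewrite (proj1 (graded_max_idealP x) nx) (proj1 (graded_max_idealP c) nc).
by rewrite mul0r add0r mulr0 !addr0.
Qed.

Let homogS (p : {mpoly k[r]}) i : p \is i.+1.-homog ->
  exists b, homog1 b /\ phi p = x1 ^+ i * b.
Proof.
have var j : homog1 (phi 'X_j).
  have Xj : ('X_j : {mpoly k[r]}) \is 1.-homog by rewrite dhomogX /= mdeg1.
  apply: homog1P; last by rewrite (tau_homog Xj).
  by apply: ideal_gen_sub; exists 1, 'X_j.
have mon m j : mdeg m = j.+1 -> exists b, homog1 b /\ phi 'X_[m] = x1 ^+ j * b.
  elim: j m => [|j IH] m mj.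
    have /mdeg1P [l /eqP ->] : mdeg m == 1 by rewrite mj.
    by exists (phi 'X_l); split; [exact: var | rewrite expr0 mul1r].
  have [l ml] : exists l, (0 < m l)%N.
    apply/existsP; apply: contraTT isT => /existsPn no.
    have m0 : m = 0%MM by apply/mnmP => l; rewrite mnm0E; apply/eqP; rewrite -leqn0 leqNgt.
    by move: mj; rewrite m0 mdeg0.
  have lm : (U_(l) <= m)%MM.
    apply/mnm_lepP => l'; rewrite mnm1E; case: eqP => [<-|] //.
  have mE := submK lm; have m'j : mdeg (m - U_(l)) = j.+1.
    by apply: succn_inj; rewrite -mj -{2}mE mdegD mdeg1 addn1.
  have [b [b1 bE]] := IH _ m'j; have [c [c1 cE]] := homog1M b1 (var l).
  exists c; split=> //; rewrite -mE mpolyXD rmorphM bE -mulrA cE mulrA -exprSr //.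
move=> /dhomogP pi; rewrite (mpolyE p) rmorph_sum big_seq.
elim/big_ind: _ => [|_ _ [b [b1 ->]] [c [c1 ->]]|m mp].
- by exists 0; split; [exists 0, 0; rewrite !rmorph0 !mul0r addr0 | rewrite mulr0].
- by exists (b + c); split; [exact: homog1D | rewrite mulrDr].
have [b [b1 bE]] := mon m i (pi m mp); exists (iota p@_m * b); split.
  exact: homog1Z.
by rewrite -mul_mpolyC rmorphM bE mulrCA.
Qed.

Let comp_homog s i : exists c d, (tau s)`_i.+1 = x1 ^+ i.+1 * iota c + x1 ^+ i * iota d * y1.
Proof.
have [p [pi ->]] := tau_coef s i.+1; have [b [[c [d ->]] ->]] := homogS pi.
by exists c, d; rewrite exprSr; ring.
Qed.

(** The components of [x^2] have degree at least two, hence are multiples of [x1] by [homogS]; so an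
    element killed by [x1] is killed by the regular element [x^2]. *)
Let x1_regular a : x1 * a = 0 -> a = 0.
Proof.
move=> xa; suff [b xxb] : exists b, x * x = x1 * b.
  by do 2!apply: reduction_regular; rewrite mulrA xxb mulrAC xa mul0r.
rewrite (sum_comp (x * x)); elim/big_ind: _ => [|_ _ [b ->] [c ->]|[[|[|i]] /= _] _].
- by exists 0; rewrite mulr0.
- by exists (b + c); rewrite mulrDr.
- by exists 0; rewrite rmorphM coef0M (proj1 (graded_max_idealP x) nx) !mul0r mulr0.
- exists 0; rewrite rmorphM coefM !big_ord_recl big_ord0 /= /bump /=.
  by rewrite (proj1 (graded_max_idealP x) nx) !mul0r !mulr0 !addr0.
have [c [d ->]] := comp_homog (x * x) i.+1.
by exists (x1 ^+ i.+1 * iota c + x1 ^+ i * iota d * y1); rewrite !exprS; ring.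
Qed.

Let x1X_regular i a : x1 ^+ i * a = 0 -> a = 0.
Proof.
elim: i => [|i IH]; first by rewrite expr0 mul1r.
by rewrite exprS -mulrA => /x1_regular.
Qed.

Let psi : {rmorphism {poly k} -> S} := horner_eval x1 \o map_poly iota.

Let psiX : psi 'X = x1.
Proof. by rewrite /psi /= map_polyX /horner_eval hornerX. Qed.

Let psiC c : psi c%:P = iota c.
Proof. by rewrite /psi /= map_polyC /horner_eval hornerC. Qed.

Let psi_coef q i : (tau (psi q))`_i = iota q`_i * x1 ^+ i.
Proof.
elim/poly_ind: q i => [|q c IH] i; first by rewrite !rmorph0 !coef0 rmorph0 mul0r.
rewrite rmorphD rmorphM psiX psiC rmorphD rmorphM tau_iota tau_comp expr1.
rewrite -scalerAr !coefD coefZ !coefMX !coefC; case: i => [|i] /=.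
  by rewrite mulr0 !add0r mulr1.
by rewrite !addr0 IH exprS mulrCA.
Qed.

Let spanning s : exists a b, s = psi a + psi b * y1.
Proof.
have comp i : exists a b, (tau s)`_i = psi a + psi b * y1.
  case: i => [|i].
    have [c ->] := tau0_scalar s; exists c%:P, 0.
    by rewrite psiC rmorph0 mul0r addr0.
  have [c [d ->]] := comp_homog s i.
  exists ('X^(i.+1) * c%:P), ('X^i * d%:P).
  by rewrite !(rmorphM psi) !(rmorphXn psi) psiX !psiC.
rewrite (sum_comp s).
elim/big_ind: _ => [|_ _ [a [b ->]] [a' [b' ->]]|i _]; last exact: comp.
- by exists 0, 0; rewrite !rmorph0 mul0r addr0.
- by exists (a + a'), (b + b'); rewrite !rmorphD mulrDl addrACA.
Qed.

Let x1_neq0 : x1 <> 0.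
Proof.
move=> e; have := @x1_regular 1; rewrite e mul0r => /(_ erefl) /eqP.
by rewrite oner_eq0.
Qed.

Let scalar_x1 c : iota c * x1 = 0 -> c = 0.
Proof.
move=> e; have [//|cn] := eqVneq c 0; case: x1_neq0.
by rewrite -[x1]mul1r -(scalar_unit cn) mulrAC e mul0r.
Qed.

Let psi_inj q : psi q = 0 -> q = 0.
Proof.
move=> q0; apply/polyP => i; rewrite coef0; apply: scalar_x1.
have := psi_coef q i; rewrite q0 rmorph0 coef0 mulrC => /esym /x1X_regular ->.
by rewrite mul0r.
Qed.

(* With [x1], [y1] the linear parts of [x], [y], the ring [S] is free over
   [k[x1]] on [1, y1], unless it is [k[x1]] itself. *)
Lemma two_generated_gorenstein : gorenstein S.
Proof.
have [S_noeth _] := S_CM.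
have [[d y1E]|y1_free] := pselect (exists d, y1 = iota d * x1).
  have /choice[lam lamE] : forall s, exists a, s = psi a.
    move=> s; have [a [b ->]] := spanning s; exists (a + b * (d%:P * 'X)).
    by rewrite rmorphD !rmorphM psiX psiC y1E.
  have psi_injective a b : psi a = psi b -> a = b.
    move=> e; apply/eqP; rewrite -subr_eq0; apply/eqP/psi_inj.
    by rewrite rmorphB e subrr.
  have lamP c s t : lam (psi c * s + t) = c * lam s + lam t.
    by apply: psi_injective; rewrite -lamE rmorphD rmorphM -!lamE.
  apply: (@frobenius_gorenstein k S psi lam lamP _ _ 1 (fun=> 1) (fun=> lam)) => //.
  - move=> g gP; exists (psi (g 1)) => t; have lam0 : lam 0 = 0.
      by apply: psi_injective; rewrite -lamE rmorph0.
    rewrite -[_ * t]addr0 lamP lam0 addr0 mulrC.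
    have g0 : g 0 = 0.
      by have := gP 1 0 0; rewrite mulr0 addr0 mul1r; exact: add_self0.
    by have := gP (lam t) 1 0; rewrite mulr1 addr0 g0 addr0 -lamE.
  - by move=> s /(_ 1); rewrite mulr1 => s0; rewrite (lamE s) s0 rmorph0.
  - by move=> s; rewrite big_ord1 mulr1.
have free a b : psi a + psi b * y1 = 0 -> a = 0 /\ b = 0.
  move=> e.
  have coefs i : iota a`_i.+1 * x1 + iota b`_i * y1 = 0.
    have := congr1 (fun q : {poly S} => q`_i.+1) (congr1 tau e).
    rewrite rmorphD rmorphM tau_comp expr1 rmorph0 coef0 coefD -scalerAr coefZ coefMX /=.
    rewrite !psi_coef => ei; apply: (@x1X_regular i); rewrite -[RHS]ei exprS; ring.
  have b0 : b = 0.
    apply/polyP => i; rewrite coef0; apply: contra_notP y1_free => /eqP bn.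
    have by1 : iota b`_i * y1 = - (iota a`_i.+1 * x1).
      by apply/eqP; rewrite -addr_eq0 addrC coefs.
    exists (- ((b`_i)^-1 * a`_i.+1)); rewrite rmorphN rmorphM mulNr -mulrA -mulrN -by1.
    by rewrite mulrA [_ * iota b`_i]mulrC (scalar_unit bn) mul1r.
  by split=> //; apply: psi_inj; rewrite b0 rmorph0 mul0r addr0 in e.
have uniq a b a' b' : psi a + psi b * y1 = psi a' + psi b' * y1 -> a = a' /\ b = b'.
  move=> e; have [] := @free (a - a') (b - b').
    by rewrite !rmorphB mulrBl addrACA e -opprD subrr.
  by move=> /eqP; rewrite subr_eq0 => /eqP -> /eqP; rewrite subr_eq0 => /eqP ->.
have /choice[ab abE] : forall s, exists ab, s = psi ab.1 + psi ab.2 * y1.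
  by move=> s; have [a [b sE]] := spanning s; exists (a, b).
have abP c s t : (ab (psi c * s + t)).1 = c * (ab s).1 + (ab t).1 /\
                 (ab (psi c * s + t)).2 = c * (ab s).2 + (ab t).2.
  apply: uniq; rewrite -abE {1}(abE s) {1}(abE t) !rmorphD !rmorphM; ring.
have ab_psi a b : ab (psi a + psi b * y1) = (a, b).
  have [] := uniq _ _ _ _ (esym (abE (psi a + psi b * y1))).
  by case: (ab _) => u v /= <- <-.
apply: (@frobenius_gorenstein k S psi (fun s => (ab s).2) _ _ _ 2
  (fun i => if i == 0 then 1 else y1)
  (fun i s => if i == 0 then (ab s).1 else (ab s).2)) => //.
- by move=> c s t; case: (abP c s t).
(* The form takes the [y1]-coordinate. If [y1^2 = u + v y1], its Gram matrix on [1, y1] has rows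
   [0, 1] and [1, v], hence determinant [-1]; solving that system gives the witness. *)
- move=> g gP; have [u [v uvE]] := spanning (y1 * y1).
  have g0 : g 0 = 0 by have := gP 1 0 0; rewrite mulr0 addr0 mul1r; exact: add_self0.
  have gE a b : g (psi a + psi b * y1) = a * g 1 + b * g y1.
    rewrite addrC gP -[psi a]mulr1 -[psi a * 1]addr0 gP g0 addr0 addrC //.
  exists (psi (g y1 - g 1 * v) + psi (g 1) * y1) => t.
  rewrite (abE t); case: (ab t) => a b /=.
  set w := (X in ab X); have -> : w = psi ((g y1 - g 1 * v) * a + g 1 * b * u) +
      psi ((g y1 - g 1 * v) * b + g 1 * a + g 1 * b * v) * y1.
    transitivity (psi (g y1 - g 1 * v) * psi a +
      (psi (g y1 - g 1 * v) * psi b + psi (g 1) * psi a) * y1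
      + psi (g 1) * psi b * (y1 * y1)); first by rewrite /w; ring.
    rewrite uvE !rmorphD !rmorphM; ring.
  by rewrite ab_psi gE /=; ring.
- move=> s s0; have := s0 1; rewrite mulr1 => s2; have := s0 y1.
  have sE := abE s; rewrite s2 rmorph0 mul0r addr0 in sE.
  have -> : s * y1 = psi 0 + psi (ab s).1 * y1 by rewrite rmorph0 add0r -sE.
  rewrite ab_psi /= => s1.
  by rewrite sE s1 rmorph0.
- by move=> i c s t; case: (abP c s t) => e1 e2; case: ifP.
- by move=> s; rewrite big_ord_recl big_ord1 /= mulr1 -abE.
Qed.

End TwoGenerated.

End GradedRing.

(** * Matrix factorizations and modules of G-dimension zero *)

Section Projective.
Variable R : comNzRingType.

Lemma linear_lift_injective (P I B : lmodType R) (j : {linear I -> B}) (f : {linear P -> B}) :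
  injective j -> (forall v, exists i, j i = f v) ->
  exists g : {linear P -> I}, forall v, j (g v) = f v.
Proof.
move=> j_inj /choice[g gE].
have lin : linear g by move=> c u v; apply: j_inj; rewrite gE !linearP !gE.
by exists (mklin lin).
Qed.

(** Projectivity is stated for surjections; both maps factor through the image of [d], onto which
    [d] is surjective. *)
Lemma projective_lift (P A B : lmodType R) (d : {linear A -> B}) (f : {linear P -> B}) :
  projective P -> (forall v, exists a, d a = f v) ->
  exists g : {linear P -> A}, forall v, d (g v) = f v.
Proof.
move=> P_proj fd; have [I [j [j_inj jE]]] := image_exists d.
have [|p pE] := @linear_lift_injective A I B j d j_inj.
  by move=> a; apply/jE; exists a.
have [|f' f'E] := @linear_lift_injective P I B j f j_inj.
  by move=> v; apply/jE/fd.
have p_onto : is_onto p.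
  move=> i; have [a aE] : exists a, d a = j i by apply/jE; exists i.
  by exists a; apply: j_inj; rewrite pE.
have [g gE] := P_proj _ _ p p_onto f'.
by exists g => v; rewrite -pE gE f'E.
Qed.

Lemma linear_rV (n : nat) (L : lmodType R) (g : {linear 'rV[R]_n -> L}) v :
  g v = \sum_i v 0 i *: g (delta_mx 0 i).
Proof.
rewrite {1}[v]row_sum_delta linear_sum; apply: eq_bigr => i _.
by rewrite linearZ.
Qed.

Lemma linear_rV_exists (n : nat) (L : lmodType R) (e : 'I_n -> L) :
  exists g : {linear 'rV[R]_n -> L}, forall v, g v = \sum_i v 0 i *: e i.
Proof.
have lin : linear (fun v : 'rV[R]_n => \sum_i v 0 i *: e i).
  move=> c u v; rewrite scaler_sumr -big_split; apply: eq_bigr => i _.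
  by rewrite !mxE scalerDl scalerA.
by exists (mklin lin).
Qed.

Lemma projective_rV (n : nat) : projective 'rV[R]_n.
Proof.
move=> A B p p_onto f.
have /choice[e eE] : forall i, exists a, p a = f (delta_mx 0 i) by move=> i; apply: p_onto.
have [g gE] := linear_rV_exists e; exists g => v.
by rewrite gE linear_sum [RHS]linear_rV; apply: eq_bigr => i _; rewrite linearZ /= eE.
Qed.

Lemma linear_form_rV (n : nat) (g : {linear 'rV[R]_n -> R^o}) :
  exists c : 'cV[R]_n, forall v, g v = (v *m c) 0 0.
Proof.
exists (\col_i g (delta_mx 0 i)) => v; rewrite linear_rV mxE.
by apply: eq_bigr => i _; rewrite mxE.
Qed.

(** A further term is available only after a related pair, so the state of the recursion holds two
    consecutive terms and the proof that they are related. *)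
Lemma dependent_sequence (T : nat -> Type) (rel : forall i, T i -> T i.+1 -> Prop)
    (t0 : T 0) :
  (exists t1, rel 0 t0 t1) ->
  (forall i t t', rel i t t' -> exists t'', rel i.+1 t' t'') ->
  exists t : forall i, T i, t 0 = t0 /\ forall i, rel i (t i) (t i.+1).
Proof.
move=> /cid[t1 r01] step.
pose st i := {p : T i * T i.+1 | rel i p.1 p.2}.
pose next i (s : st i) : st i.+1 :=
  let u := cid (step i _ _ (svalP s)) in
  exist (fun p => rel i.+1 p.1 p.2) ((sval s).2, sval u) (svalP u).
pose s0 : st 0 := exist (fun p => rel 0 p.1 p.2) (t0, t1) r01.
pose s := nat_rect st s0 next.
exists (fun i => (sval (s i)).1); split=> // i.
exact: (svalP (s i)).
Qed.

Section Comparison.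
Variables (M N : lmodType R) (P Q : proj_resolution M).

Lemma chain_map_exists (P' Q' : proj_resolution M) :
  exists A : forall i, {linear pr_obj P' i -> pr_obj Q' i},
    (forall v, pr_aug Q' (A 0 v) = pr_aug P' v) /\
    forall i v, pr_diff Q' i (A i.+1 v) = A i (pr_diff P' i v).
Proof.
have [A0 A0E] := projective_lift (@pr_proj _ _ P' 0) (fun v => pr_surj Q' (pr_aug P' v)).
have [||A [A00 AE]] := @dependent_sequence
  (fun i => {linear pr_obj P' i -> pr_obj Q' i})
  (fun i a a' => forall v, pr_diff Q' i (a' v) = a (pr_diff P' i v)) A0.
- apply: (@projective_lift _ _ _ _ (A0 \o pr_diff P' 0)); first exact: pr_proj.
  move=> v; apply/(@pr_exact0 _ _ Q' _); rewrite A0E; apply/(@pr_exact0 _ _ P' _).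
  by exists v.
- move=> i a a' aE; apply: (@projective_lift _ _ _ _ (a' \o pr_diff P' i.+1)); first exact: pr_proj.
  move=> v; apply/(@pr_exact _ _ Q' _ _); rewrite /= aE.
  suff -> : pr_diff P' i (pr_diff P' i.+1 v) = 0 by rewrite linear0.
  by apply/(@pr_exact _ _ P' _ _); exists v.
by exists A; rewrite A00.
Qed.

Lemma diff_diff (P' : proj_resolution M) i v : pr_diff P' i (pr_diff P' i.+1 v) = 0.
Proof. by apply/(@pr_exact _ _ P' _ _); exists v. Qed.

(** With comparison maps [A : P -> Q] and [B : Q -> P], the chain map [C = 1 - B A] has a
    null-homotopy, [C = d s + s d]. A cocycle [g] kills [d s], so [g = g s d + g B A], where [g B]
    is a coboundary on [Q]. *)
Lemma ext_vanishing_comparison i :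
  (forall g : {linear pr_obj Q i.+1 -> N}, (forall v, g (pr_diff Q i.+1 v) = 0) ->
     exists h : {linear pr_obj Q i -> N}, forall v, g v = h (pr_diff Q i v)) ->
  forall g : {linear pr_obj P i.+1 -> N}, (forall v, g (pr_diff P i.+1 v) = 0) ->
     exists h : {linear pr_obj P i -> N}, forall v, g v = h (pr_diff P i v).
Proof.
move=> Q_ext g gd; have [A [A_aug AE]] := chain_map_exists P Q.
have [B [B_aug BE]] := chain_map_exists Q P.
pose C j : {linear pr_obj P j -> pr_obj P j} := idfun \- (B j \o A j).
have CE j v : pr_diff P j (C j.+1 v) = C j (pr_diff P j v).
  by rewrite /C /= linearB BE AE.
have [s0 s0E] : exists s : {linear pr_obj P 0 -> pr_obj P 1}, forall v, pr_diff P 0 (s v) = C 0 v.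
  apply: projective_lift; first exact: pr_proj.
  by move=> v; apply/(@pr_exact0 _ _ P _); rewrite /C /= linearB B_aug A_aug subrr.
have [||s [s_0 sE]] := @dependent_sequence
  (fun j => {linear pr_obj P j -> pr_obj P j.+1})
  (fun j s s' => forall v, pr_diff P j.+1 (s' v) = C j.+1 v - s (pr_diff P j v)) s0.
- apply: (@projective_lift _ _ _ _ (C 1 \- (s0 \o pr_diff P 0))); first exact: pr_proj.
  by move=> v; apply/(@pr_exact _ _ P _ _); rewrite /= linearB s0E CE subrr.
- move=> j s s' sE; apply: (@projective_lift _ _ _ _ (C j.+2 \- (s' \o pr_diff P j.+1))); first exact: pr_proj.
  by move=> v; apply/(@pr_exact _ _ P _ _); rewrite /= linearB sE CE diff_diff linear0 subr0 subrr.
have [|h hE] := Q_ext (g \o B i.+1); first by move=> v; rewrite /= -BE gd.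
exists ((g \o s i) \+ (h \o A i)) => v.
rewrite /= -AE -hE /=.
have := gd (s i.+1 v); rewrite sE linearB => /eqP; rewrite subr_eq0 => /eqP <-.
by rewrite -linearD /C /= subrK.
Qed.

End Comparison.

Lemma ExtS_vanishes_resolution (M N : lmodType R) (Q : proj_resolution M) i :
  (forall g : {linear pr_obj Q i.+1 -> N}, (forall v, g (pr_diff Q i.+1 v) = 0) ->
     exists h : {linear pr_obj Q i -> N}, forall v, g v = h (pr_diff Q i v)) ->
  ExtS_vanishes i M N.
Proof. by move=> Q_ext P; apply: ext_vanishing_comparison Q_ext. Qed.

End Projective.

Lemma dual_linear (R : comNzRingType) (M : lmodType R) (f : dual M) :
  linear (f : M -> R^o).
Proof. by apply/asboolP; case: f. Qed.

Section ExactPairs.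
Variable R : comNzRingType.

Definition row_exact (n : nat) (a b : 'M[R]_n) :=
  forall v : 'rV_n, v *m a = 0 <-> exists w, v = w *m b.

(** The transposed conditions say that the dual of the two-periodic complex is exact too, i.e. that
    the complex is totally acyclic. *)
Definition exact_pair (n : nat) (a b : 'M[R]_n) :=
  [/\ row_exact a b, row_exact b a, row_exact a^T b^T & row_exact b^T a^T].

Lemma exact_pair_sym n (a b : 'M[R]_n) : exact_pair a b -> exact_pair b a.
Proof. by case. Qed.

Lemma exact_pair_tr n (a b : 'M[R]_n) : exact_pair a b -> exact_pair a^T b^T.
Proof. by case=> *; split; rewrite ?trmxK. Qed.

Lemma exact_pair_col n (a b : 'M[R]_n) (v : 'cV_n) : exact_pair a b ->
  a *m v = 0 <-> exists w, v = b *m w.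
Proof.
case=> _ _ ex _; split=> [av|[w ->]].
  have [|w wE] := (proj1 (ex v^T)); first by rewrite -trmx_mul av trmx0.
  by exists w^T; rewrite -[LHS]trmxK wE trmx_mul trmxK.
apply: trmx_inj; rewrite trmx0 trmx_mul; apply/(ex (b *m w)^T).
by exists w^T; rewrite trmx_mul.
Qed.

Lemma periodic_Ext_vanishes n (a b : 'M[R]_n) (L : lmodType R)
    (aug : {linear 'rV[R]_n -> L}) :
  exact_pair a b -> is_onto aug -> (forall v, aug v = 0 <-> exists w, v = w *m a) ->
  forall i, ExtS_vanishes i L R^o.
Proof.
move=> ab aug_onto aug_ker i.
pose c j := if odd j then b else a.
have c_pair j : exact_pair (c j) (c j.+1).
  by rewrite /c /=; case: odd => //; apply: exact_pair_sym.
have c_exact j : row_exact (c j) (c j.+1) by case: (c_pair j).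
pose dif j : {linear 'rV[R]_n -> 'rV[R]_n} := mulmxr (c j).
have ex0 : exact (dif 0) aug.
  by move=> v; rewrite aug_ker; split=> -[w e]; exists w; rewrite ?e // -e.
have ex j : exact (dif j.+1) (dif j).
  by move=> v /=; rewrite c_exact; split=> -[w e]; exists w; rewrite ?e // -e.
pose Q := @ProjResolution R L (fun=> 'rV[R]_n) dif aug (fun=> @projective_rV R n) aug_onto ex0 ex.
apply: (@ExtS_vanishes_resolution R L R^o Q) => g /= gd.
have [w wE] := linear_form_rV g.
have /(exact_pair_col _ (exact_pair_sym (c_pair i))) [u uE] : c i.+1 *m w = 0.
  apply/colP => j; have := gd (delta_mx 0 j); rewrite wE -mulmxA -rowE !mxE.
  by [].
have lin : linear (fun v : 'rV[R]_n => (v *m u) 0 0 : R^o).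
  by move=> d v v'; rewrite mulmxDl -scalemxAl !mxE.
by exists (mklin lin) => v /=; rewrite wE uE mulmxA.
Qed.

(** Forms on the cokernel [M] of [a] are the columns killed by [a], that is, the columns [b t]; so
    the dual is the cokernel of [a^T], with the same periodic resolution. A form on the dual is a
    row killed by [a], hence of the shape [w b], which is evaluation at [e w]. *)
Lemma exact_pair_Gdim0 n (a b : 'M[R]_n) : exact_pair a b ->
  exists (M : lmodType R) (e : {linear 'rV[R]_n -> M}),
    [/\ is_onto e, forall v, e v = 0 <-> exists w, v = w *m a & Gdim0 M].
Proof.
move=> ab; have [ab1 ba1 ab2 ba2] := ab.
have Wsub : submodule [set v : 'rV[R]_n | exists w, v = w *m a].
  split; first by exists 0; rewrite mul0mx.
    by move=> _ _ [u ->] [v ->]; exists (u + v); rewrite mulmxDl.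
  by move=> c _ [u ->]; exists (c *: u); rewrite scalemxAl.
have [M [e [e_onto e_ker]]] := quotient_exists Wsub.
exists M, e; split=> //.
have [s sK] := choice e_onto.
have vb u v : e u = e v -> u *m b = v *m b.
  move=> euv; apply/eqP; rewrite -subr_eq0 -mulmxBl; apply/eqP/ba1/e_ker.
  by rewrite linearB euv subrr.
have form_lin (t : 'cV[R]_n) : linear (fun m : M => (s m *m b *m t) 0 0 : R^o).
  move=> c m m'; suff -> : s (c *: m + m') *m b = c *: (s m *m b) + s m' *m b.
    by rewrite mulmxDl -scalemxAl !mxE.
  by rewrite scalemxAl -mulmxDl; apply: vb; rewrite linearP !sK.
have form_pred (t : 'cV[R]_n) : (fun m : M => (s m *m b *m t) 0 0 : R^o) \in @dual_pred R M.
  by apply/asboolP; apply: form_lin.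
pose form (t : 'cV[R]_n) : dual M := Dual (form_pred t).
have formE t v : form t (e v) = (v *m b *m t) 0 0.
  by rewrite /= (vb _ v) // sK.
have dual_ext (f g : dual M) : (forall v, f (e v) = g (e v)) -> f = g.
  by move=> fg; apply/val_inj/funext => m; rewrite -(sK m); apply: fg.
have form_linear c t u : form (c *: t + u) = c *: form t + form u.
  apply: dual_ext => v; rewrite formE.
  by rewrite -[RHS]/(c * form t (e v) + form u (e v)) !formE mulmxDr -scalemxAr !mxE.
have form_onto f : exists t, f = form t.
  have flin := @dual_linear R M f.
  have felin : linear (fun v => f (e v) : R^o) by move=> c u v; rewrite linearP flin.
  have [c cE] := linear_form_rV (mklin felin); rewrite /= in cE.
  have f0 : f 0 = 0.
    by have := flin 1 0 0; rewrite scaler0 addr0 scale1r; apply: add_self0.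
  have /(exact_pair_col _ ab) [t tE] : a *m c = 0.
    apply/colP => j; rewrite [RHS]mxE; have := cE (row j a).
    have -> : e (row j a) = 0 by apply/e_ker; exists (delta_mx 0 j); rewrite -rowE.
    by rewrite f0 -row_mul [row _ _ _ _]mxE.
  by exists t; apply: dual_ext => v; rewrite formE cE tE mulmxA.
split.
- exists n, (fun i => e (delta_mx 0 i)) => m; exists (fun i => s m 0 i).
  by rewrite -(sK m) {1}linear_rV sK.
- have bid_inj : injective (@biduality R M).
    move=> m m' mm'; rewrite -(sK m) -(sK m'); apply/eqP; rewrite -subr_eq0 -linearB.
    apply/eqP/e_ker/ba1/rowP => i; rewrite mulmxBl.
    have e1 : (s m *m b) 0 i = (s m' *m b) 0 i.
      have := congr1 (fun D : dual (dual M) => D (form (delta_mx i 0))) mm'.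
      by rewrite /= -!colE [col _ _ _ _]mxE [in RHS]mxE.
    by rewrite !mxE in e1 *; rewrite e1 subrr.
  have bid_onto : is_onto (@biduality R M).
    move=> D; have Dlin := @dual_linear R (dual M) D.
    have DElin : linear (fun t : 'rV[R]_n => D (form t^T) : R^o).
      by move=> c t u; rewrite -Dlin linearP form_linear.
    have [c cE] := linear_form_rV (mklin DElin); rewrite /= in cE.
    have D0 : D 0 = 0.
      by have := Dlin 1 0 0; rewrite scaler0 addr0 scale1r; apply: add_self0.
    have /ab1 [w wE] : c^T *m a = 0.
      apply/rowP => j; rewrite [RHS]mxE.
      have := cE (col j a)^T; rewrite trmxK.
      have -> : form (col j a) = 0.
        apply: dual_ext => v; rewrite formE -[RHS]/(0 : R) colE mulmxA -[v *m b *m a]mulmxA.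
        have -> : v *m (b *m a) = 0 by rewrite mulmxA; apply/ab1; exists v.
        by rewrite mul0mx mxE.
      rewrite D0 => /esym <-; rewrite !mxE; apply: eq_bigr => i _.
      by rewrite !mxE mulrC.
    exists (e w); apply/val_inj/funext => f; have [t ->] := form_onto f.
    rewrite -[LHS]/(form t (e w)) -[RHS]/(D (form t)) formE -wE; have := cE t^T; rewrite trmxK => ->.
    by rewrite !mxE; apply: eq_bigr => i _; rewrite !mxE mulrC.
  by exists (fun D => sval (cid (bid_onto D))) => [m|D]; [apply: bid_inj|]; case: (cid _).
- exact: periodic_Ext_vanishes ab e_onto e_ker.
have dlin : linear (fun w : 'rV[R]_n => form w^T).
  by move=> c u v; rewrite linearP form_linear.
apply: (periodic_Ext_vanishes (exact_pair_tr ab) (aug := mklin dlin)).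
  by move=> f; have [t ->] := form_onto f; exists t^T; rewrite /= trmxK.
move=> v /=; split=> [fv|[w ->]].
  have /(exact_pair_col _ (exact_pair_sym ab)) [w wE] : b *m v^T = 0.
    apply/colP => i; have := congr1 (fun f : dual M => f (e (delta_mx 0 i))) fv.
    by rewrite formE -mulmxA -rowE -[RHS]/(0 : R) !mxE.
  by exists w^T; rewrite -[LHS]trmxK wE trmx_mul.
apply: dual_ext => u; rewrite formE trmx_mul trmxK -[RHS]/(0 : R) -mulmxA.
have -> : b *m (a *m w^T) = 0.
  by apply/(exact_pair_col _ (exact_pair_sym ab)); exists w^T.
by rewrite mulmx0 mxE.
Qed.

End ExactPairs.

(** Lift a row killed by [a] modulo [z] to [u]. Then [u a = z t], so [z u = u a b = z (t b)], and
    the regular element [z] cancels. *)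
Lemma matrix_factorization_exact_pair (S R : comNzRingType) (rho : {rmorphism S -> R})
    (z : S) (n : nat) (a b : 'M[S]_n) :
  is_onto rho -> (forall s, rho s = 0 <-> exists t, s = z * t) ->
  (forall s, z * s = 0 -> s = 0) -> a *m b = z%:M -> b *m a = z%:M ->
  exact_pair (map_mx rho a) (map_mx rho b).
Proof.
move=> rho_onto rho_ker z_reg ab ba; have [l lK] := choice rho_onto.
have rho_z : rho z = 0 by apply/rho_ker; exists 1; rewrite mulr1.
have key m (c d : 'M[S]_m) : c *m d = z%:M -> d *m c = z%:M ->
    row_exact (map_mx rho c) (map_mx rho d).
  move=> cd dc v; split=> [vc|[w ->]]; last first.
    by rewrite -mulmxA -map_mxM dc map_scalar_mx /= rho_z raddf0 mulmx0.
  pose u := map_mx l v; have uE : map_mx rho u = v.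
    by apply/rowP => i; rewrite !mxE lK.
  have /choice[t tE] : forall i, exists t, (u *m c) 0 i = z * t.
    move=> i; apply/rho_ker; rewrite -uE -map_mxM in vc.
    by have := congr1 (fun X : 'rV_m => X 0 i) vc; rewrite mxE [in RHS]mxE.
  exists (map_mx rho (\row_i t i)); rewrite -map_mxM -uE; congr map_mx.
  apply/eqP; rewrite -subr_eq0; apply/eqP/rowP => i; rewrite [RHS]mxE; apply: z_reg.
  have : z *: u = z *: ((\row_i t i) *m d).
    rewrite -mul_mx_scalar -cd mulmxA scalemxAl; congr (_ *m _).
    by apply/rowP => j; rewrite tE !mxE.
  move=> /eqP; rewrite -subr_eq0 -scalerBr => /eqP /(congr1 (fun X : 'rV_m => X 0 i)).
  by rewrite [LHS]mxE [RHS]mxE.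
have tr (c d : 'M[S]_n) : c *m d = z%:M -> d^T *m c^T = z%:M.
  by move=> cd; rewrite -trmx_mul cd tr_scalar_mx.
split; [exact: key | exact: key | |]; rewrite !map_trmx; apply: key; exact: tr.
Qed.

(** On columns of coefficients this is multiplication by the series [p] modulo [t^n]. Row [j] reads
    as the relation [p_0 e_j + ... + p_j e_0], so for [p = x - y1 t] the rows present the module
    [M_(n-1)] of the overview. *)
Definition toeplitz (R : comNzRingType) (p : nat -> R) n : 'M[R]_n :=
  \matrix_(i, j) if (j <= i)%N then p (i - j)%N else 0.

Lemma toeplitzM (R : comNzRingType) (p q : nat -> R) n :
  toeplitz p n *m toeplitz q n =
  toeplitz (fun j => \sum_(l < j.+1) p (j - l)%N * q l) n.
Proof.
apply/matrixP => i j; rewrite !mxE.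
pose F l := (if (l <= i)%N then p (i - l)%N else 0) * (if (j <= l)%N then q (l - j)%N else 0).
transitivity (\sum_(0 <= l < n) F l).
  by rewrite big_mkord; apply: eq_bigr => l _; rewrite !mxE.
have [ji|ij] := leqP j i; last first.
  rewrite big1_seq // => l _; rewrite /F; have [li|] := leqP l i; last by rewrite mul0r.
  by rewrite (leqNgt j) (leq_ltn_trans li ij) mulr0.
rewrite (@big_cat_nat _ _ _ j) //=; last exact: ltnW (ltn_ord j).
rewrite big1_seq ?add0r => [|l]; last first.
  by rewrite mem_index_iota /F => /andP[_ /andP[_ lj]]; rewrite (leqNgt j) lj mulr0.
rewrite (@big_cat_nat _ _ _ i.+1) ?leqW //= ?ltn_ord //.
rewrite [X in _ + X]big1_seq ?addr0 => [|l]; last first.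
  by rewrite mem_index_iota /F => /andP[_ /andP[il _]]; rewrite (leqNgt l) il mul0r.
rewrite -{1}[nat_of_ord j]add0n big_addn subSn // big_mkord; apply: eq_bigr => l _.
rewrite /F leq_addl addnK; have -> : (l + j <= i)%N by rewrite addnC -leq_subRL // -ltnS.
by rewrite subnDA subnAC.
Qed.

Lemma toeplitz_scalar (R : comNzRingType) (p : nat -> R) n :
  (forall j, p j.+1 = 0) -> toeplitz p n = (p 0)%:M.
Proof.
move=> p0; apply/matrixP => i j; rewrite !mxE -val_eqE /=.
by case: ltngtP => [ji|ij|->] //; rewrite ?subnn // -(subnSK ji) p0.
Qed.

Lemma map_toeplitz (S R : comNzRingType) (rho : {rmorphism S -> R}) p n :
  map_mx rho (toeplitz p n) = toeplitz (rho \o p) n.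
Proof. by apply/matrixP => i j; rewrite !mxE; case: ifP => // _; rewrite rmorph0. Qed.

Lemma toeplitzC (R : comNzRingType) (p q : nat -> R) n :
  toeplitz p n *m toeplitz q n = toeplitz q n *m toeplitz p n.
Proof.
have conv_sym j : \sum_(l < j.+1) p (j - l)%N * q l = \sum_(l < j.+1) q (j - l)%N * p l.
  rewrite (reindex_inj (@rev_ord_inj j.+1)) /=; apply: eq_bigr => l _.
  by rewrite subSS subKn ?leq_ord // mulrC.
by rewrite !toeplitzM; apply/matrixP => i j; rewrite !mxE; case: (j <= i)%N; rewrite ?conv_sym.
Qed.

(** * Towers in the cosyzygies of a module of G-dimension zero *)

Section LocalRing.
Variables (k : fieldType) (R : comNzRingType).
Variables (iota : {rmorphism k -> R}) (res : {rmorphism R -> k}) (x y1 y2 : R).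
Hypothesis resK : forall c, res (iota c) = c.
Hypothesis res_mul : forall a b, res a = 0 -> res b = 0 ->
  exists c, res c = 0 /\ a * b = x * c.
Hypothesis x_ann : forall a, x * a = 0 <-> exists b, a = x * b.
Hypothesis res_y1 : res y1 = 0.
Hypothesis y1_x : forall b, y1 <> x * b.
Hypothesis y2_xy1 : forall a b, y2 <> x * a + b * y1.
Hypothesis res_y2 : res y2 = 0.
Hypothesis R_noeth : noetherian R.

Let xx0 : x * x = 0. Proof. by apply/x_ann; exists 1; rewrite mulr1. Qed.

Let mul3 a b : res a = 0 -> res b = 0 -> a * (x * b) = 0.
Proof.
by move=> a0 b0; have [c [_ e]] := res_mul a0 b0; rewrite mulrCA e mulrA xx0 mul0r.
Qed.

Let res_unit a : res a != 0 -> exists b, a * b = 1.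
Proof.
move=> an; pose v := 1 - iota (res a)^-1 * a.
have v0 : res v = 0 by rewrite rmorphB rmorph1 rmorphM resK mulVf ?subrr.
have [c [c0 vv]] := res_mul v0 v0; have := mul3 v0 c0; rewrite -vv => v3.
(* A geometric series, finite because [v] lies in the maximal ideal, whose cube is zero. *)
exists (iota (res a)^-1 * (1 + v + v * v)).
transitivity ((1 - v) * (1 + v + v * v)); first by rewrite /v; ring.
by transitivity (1 - v * (v * v)); [ring | rewrite v3 subr0].
Qed.

(* [v] lies in [m^2 F = x m F]; membership in [m F] is [map_mx res v = 0]. *)
Definition in_m2 (n : nat) (v : 'cV[R]_n) :=
  exists w : 'cV[R]_n, map_mx res w = 0 /\ v = x *: w.

Lemma res_mulmx m n (A : 'M[R]_(m, n)) (v : 'cV[R]_n) :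
  map_mx res A = 0 -> map_mx res v = 0 -> in_m2 (A *m v).
Proof.
move=> A0 v0.
have resA i j : res (A i j) = 0 by have := congr1 (fun X : 'M_(m, n) => X i j) A0; rewrite !mxE.
have resv j : res (v j 0) = 0 by have := congr1 (fun X : 'cV_n => X j 0) v0; rewrite !mxE.
have /choice[c cP] : forall ij : 'I_m * 'I_n, exists c, res c = 0 /\ A ij.1 ij.2 * v ij.2 0 = x * c.
  by move=> [i j]; apply: res_mul.
exists (\col_i \sum_j c (i, j)); split; apply/colP => i; rewrite !mxE.
  by rewrite rmorph_sum big1 // => j _; case: (cP (i, j)).
by rewrite mulr_sumr; apply: eq_bigr => j _; case: (cP (i, j)).
Qed.

Lemma mulmx_in_m2 m n (A : 'M[R]_(m, n)) (v : 'cV[R]_n) :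
  map_mx res A = 0 -> in_m2 v -> A *m v = 0.
Proof.
move=> A0 [w [w0 ->]]; have [u [_ uE]] := res_mulmx A0 w0.
by rewrite -scalemxAr uE scalerA xx0 scale0r.
Qed.

(** A unit coefficient would put [x y2] on the line [R x y1], hence [y2] in [x R + y1 R] because
    [0 : x = x R]. The second independent element serves exactly here. *)
Lemma socle_form n (p : 'rV[R]_n) :
  (forall v, in_m2 v -> exists b, (p *m v) 0 0 = b * (x * y1)) -> map_mx res p = 0.
Proof.
move=> pP; apply/rowP => j; rewrite !mxE; apply/eqP; apply: contraT => pj.
have [u pu] := res_unit pj.
have [|b bE] := pP (x *: (y2 *: delta_mx j 0)).
  exists (y2 *: delta_mx j 0); split=> //; apply/colP => i.
  by rewrite !mxE rmorphM res_y2 mul0r.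
move: bE; rewrite -!scalemxAr -colE !mxE => bE.
have /x_ann [d dE] : x * (y2 * p 0 j - b * y1) = 0 by rewrite mulrBr bE; ring.
case: (@y2_xy1 (u * d) (u * b)).
transitivity (u * (y2 * p 0 j)); first by rewrite mulrCA [u * _]mulrC pu mulr1.
by rewrite -[y2 * _](subrK (b * y1)) dE; ring.
Qed.

(** Linear algebra over [k]: modulo the maximal ideal [V] becomes a row space, and a column of its
    cokernel matrix that does not kill [w], rescaled and lifted along [iota], is the form. *)
Lemma separating_form n (V : set 'cV[R]_n) (w : 'cV[R]_n) :
  submodule V -> ~ (exists v, V v /\ map_mx res (w - v) = 0) ->
  exists t : 'rV[R]_n, (forall v, V v -> res ((t *m v) 0 0) = 0) /\ res ((t *m w) 0 0) = 1.
Proof.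
move=> [V0 VD VZ] w_notin.
have k_noeth : noetherian k.
  move=> I [I0 ID IM]; have [[c [Ic cn]]|no] := pselect (exists c, I c /\ c != 0).
    exists [:: 1]; apply/seteqP; split=> a _; last first.
      by rewrite -[a]mulr1 -(mulVf cn) mulrA; apply: IM.
    by exists 1, (fun=> a), (fun=> 1); split; rewrite ?big_ord1 ?mulr1 //= inE.
  exists [::]; apply/seteqP; split=> a => [Ia|/ideal_genP [c ->]]; last first.
    by rewrite mxE big_ord0.
  have -> : a = 0 by apply/eqP; apply: contra_notT no => an; exists a.
  by case: (@ideal_gen_ideal k [set` [::]]).
have [|m [B BP]] := @noetherian_rV k n
    [set v' | exists v, V v /\ v' = (map_mx res v)^T] k_noeth.
  split; first by exists 0; split=> //; rewrite map_mx0 trmx0.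
    move=> _ _ [u [Vu ->]] [v [Vv ->]]; exists (u + v).
    by split; [apply: VD | rewrite map_mxD raddfD].
  move=> c _ [v [Vv ->]]; exists (iota c *: v).
  by split; [apply: VZ | rewrite map_mxZ linearZ /= resK].
have : ~~ ((map_mx res w)^T <= B)%MS.
  apply: contra_notN w_notin => /submxP /BP [v [Vv /trmx_inj e]].
  by exists v; split=> //; rewrite map_mxB e subrr.
rewrite submxE => /eqP wB.
have [j wj] : exists j, ((map_mx res w)^T *m cokermx B) 0 j != 0.
  apply: contrapT => no; apply: wB; apply/rowP => j; rewrite [RHS]mxE.
  by apply/eqP; apply: contra_notT no => nj; exists j.
pose c := ((map_mx res w)^T *m cokermx B) 0 j.
pose t : 'rV[R]_n := map_mx iota (c^-1 *: (col j (cokermx B))^T).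
have tE v : res ((t *m v) 0 0) = c^-1 * ((map_mx res v)^T *m cokermx B) 0 j.
  rewrite !mxE rmorph_sum mulr_sumr; apply: eq_bigr => i _.
  by rewrite !mxE rmorphM resK; ring.
exists t; split=> [v Vv|]; last by rewrite tE mulVf.
rewrite tE; have /BP [d ->] : exists v', V v' /\ (map_mx res v)^T = (map_mx res v')^T by exists v.
by rewrite -mulmxA mulmx_coker mulmx0 mxE mulr0.
Qed.

Definition conv (p : nat -> R) n (u : nat -> 'cV[R]_n) j : 'cV[R]_n :=
  \sum_(i < j.+1) p (j - i)%N *: u i.

(** The last clause says that, modulo [t^(N+1)], a series of vectors killed by [p] is a multiple of
    [q]. *)
Definition half_pair (p q : nat -> R) :=
  [/\ forall j, res (p j) = 0, p 0 = x, forall b, p 1 <> x * b &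
      forall n (N : nat) (u : nat -> 'cV[R]_n), (forall j, (j <= N)%N -> conv p u j = 0) ->
        exists f, forall j, (j <= N)%N -> u j = conv q f j].

(* Truncations of power series [p], [q] that lift to [S] with [p q = x^2] there. *)
Definition series_pair p q := half_pair p q /\ half_pair q p.

Section Tower.
Variables (c : nat -> nat) (D : forall i, 'M[R]_(c i.+1, c i)).
Hypothesis D_min : forall i, map_mx res (D i) = 0.
Hypothesis DD : forall i, D i.+1 *m D i = 0.
Hypothesis D_exact : forall i (w : 'cV_(c i.+1)), D i.+1 *m w = 0 -> exists f, w = D i *m f.
Hypothesis D_dual_exact : forall i (p : 'rV_(c i)),
  (forall v : 'cV_(c i), D i *m v = 0 -> p *m v = 0) -> exists p', p = p' *m D i.

(* Discarding [x ker D_i] makes the condition survive the free summands of [X]. *)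
Let good i (u : 'cV_(c i)) := ~ exists v, D i *m v = 0 /\ in_m2 (u - x *: v).

(** Suppose [D f0] is in [m^2 F] with [f0 = f - x f']. As [x f] is good, [f0] is not in [ker D]
    modulo [m], so some form [t] is [1] at [f0] modulo [m] and maps [ker D] into [m]. Then [x y1 t]
    vanishes on [ker D], hence equals [p D]; once [p] is in [m], [x y1 = p D f0 = 0], contradicting
    that [y1] is not in [x R]. *)
Let good_next i (f : 'cV_(c i)) : good (x *: f) -> good (D i *m f).
Proof.
move=> f_good [v' [/D_exact [f' ->]]].
rewrite scalemxAr -mulmxBr; set f0 := f - x *: f' => Df0.
have sep : exists t : 'rV[R]_(c i),
    (forall v : 'cV_(c i), D i *m v = 0 -> res ((t *m v) 0 0) = 0) /\ res ((t *m f0) 0 0) = 1.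
  apply: (separating_form (V := [set v : 'cV_(c i) | D i *m v = 0])).
    split=> [|u v /= Du Dv|b v /= Dv]; first exact: mulmx0.
      by rewrite mulmxDr Du Dv addr0.
    by rewrite -scalemxAr Dv scaler0.
  move=> [v [Dv fv]]; apply: f_good; exists v; split=> //.
  exists (f0 - v); split=> //.
  by rewrite scalerBr /f0 scalerBr scalerA xx0 scale0r subr0.
have [t [tV tf0]] := sep.
have s_res a : res a = 0 -> x * y1 * a = 0.
  by move=> a0; rewrite mulrC; apply: mul3.
have [|p pE] := @D_dual_exact i (x * y1 *: t).
  move=> v Dv; apply/matrixP => a b; rewrite !ord1 -scalemxAl [LHS]mxE [RHS]mxE.
  exact/s_res/tV.
(* By minimality [m^2 F] lies in the kernel of the next differential, hence in the image of [D i],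
   where [p] takes the values [x y1 (t f1)]. *)
have p0 : map_mx res p = 0.
  apply: socle_form => v v2.
  have [f1 ->] := D_exact (mulmx_in_m2 (D_min i.+1) v2).
  exists ((t *m f1) 0 0); rewrite mulmxA -pE -scalemxAl mxE; exact: mulrC.
have := mulmx_in_m2 p0 Df0; rewrite mulmxA -pE -scalemxAl.
move=> /(congr1 (fun X : 'M_1 => X 0 0)); rewrite mxE [RHS]mxE.
have -> : (t *m f0) 0 0 = 1 + ((t *m f0) 0 0 - 1) by ring.
rewrite mulrDr (s_res (_ - 1)) ?addr0 ?mulr1; last by rewrite rmorphB tf0 rmorph1 subrr.
by move=> /x_ann [b /y1_x].
Qed.

(** Write [u = q f]. By induction for the swapped pair, [D f_n] is independent of its predecessors
    modulo [m^2]; as [D] has entries in [m], [f_n] is independent of its predecessors modulo [m]. A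
    form that is [1] at [f_n] modulo [m] and in [m] at the earlier [f_j] sends [u_0, ..., u_n] into
    [x R], but [u_(n+1)] to [q_1] modulo [x R]. *)
Lemma tower_independent n : forall p q i (u : nat -> 'cV_(c i)), series_pair p q ->
  (forall j, (j <= n)%N -> D i *m u j = 0) ->
  (forall j, (j <= n)%N -> conv p u j = 0) -> good (u 0) ->
  ~ exists a : nat -> R, in_m2 (u n - \sum_(j < n) a j *: u j).
Proof.
elim: n => [|n IH] p q i u pq Du pu u_good [a ua].
  apply: u_good; exists 0; rewrite mulmx0; split=> //.
  by move: ua; rewrite big_ord0 scaler0.
have [[p_res p0 p1 p_ex] [q_res q0 q1 q_ex]] := pq.
have [f fE] := p_ex _ n.+1 u pu.
have u0 : u 0 = x *: f 0 by rewrite fE // /conv big_ord1 subnn q0.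
pose g j := D i *m f j.
have g_good : good (g 0) by apply: good_next; rewrite -u0.
have g_tower j : (j <= n)%N -> conv q g j = 0.
  move=> jn; have := Du j (leqW jn); rewrite fE ?leqW // /conv mulmx_sumr => e; rewrite -[RHS]e.
  by apply: eq_bigr => l _; rewrite -scalemxAr.
have Dg j : D i.+1 *m g j = 0 by rewrite mulmxA DD mul0mx.
have g_indep := IH q p i.+1 g (conj pq.2 pq.1) (fun j _ => Dg j) g_tower g_good.
have sep : exists t : 'rV[R]_(c i),
    (forall v : 'cV_(c i), (exists b : nat -> R, v = \sum_(j < n) b j *: f j) -> res ((t *m v) 0 0) = 0) /\
    res ((t *m f n) 0 0) = 1.
  apply: (separating_form (V := [set v : 'cV_(c i) | exists b : nat -> R, v = \sum_(j < n) b j *: f j])).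
    split.
    - by exists (fun=> 0); rewrite big1 // => j _; rewrite scale0r.
    - move=> _ _ [b ->] [b' ->]; exists (fun j => b j + b' j); rewrite -big_split.
      by apply: eq_bigr => j _; rewrite scalerDl.
    - move=> d _ [b ->]; exists (fun j => d * b j); rewrite scaler_sumr.
      by apply: eq_bigr => j _; rewrite scalerA.
  move=> [_ [[b ->] fb]]; apply: g_indep; exists b.
  suff -> : g n - \sum_(j < n) b j *: g j = D i *m (f n - \sum_(j < n) b j *: f j).
    exact: res_mulmx.
  rewrite mulmxBr mulmx_sumr; congr (_ - _).
  by apply: eq_bigr => j _; rewrite -scalemxAr.
have [t [tV tf]] := sep.
pose tv (v : 'cV_(c i)) := (t *m v) 0 0.
have tvD v w : tv (v + w) = tv v + tv w by rewrite /tv mulmxDr mxE.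
have tvZ b v : tv (b *: v) = b * tv v by rewrite /tv -scalemxAr mxE.
have tv_sum (I : finType) (F : I -> 'cV_(c i)) : tv (\sum_i0 F i0) = \sum_i0 tv (F i0).
  by rewrite /tv mulmx_sumr summxE.
pose xR b := exists d, b = x * d.
have xR0 : xR 0 by exists 0; rewrite mulr0.
have xRD b b' : xR b -> xR b' -> xR (b + b').
  by move=> [d ->] [d' ->]; exists (d + d'); rewrite mulrDr.
have xRM b b' : xR b' -> xR (b * b').
  by move=> [d ->]; exists (b * d); rewrite mulrCA.
have xR_res b b' : res b = 0 -> res b' = 0 -> xR (b * b').
  by move=> b0 b'0; have [d [_ e]] := res_mul b0 b'0; exists d.
have tf_res j : (j < n)%N -> res (tv (f j)) = 0.
  move=> jn; apply: tV; exists (fun l => (l == j)%:R).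
  rewrite (bigD1 (Ordinal jn)) //= eqxx scale1r big1 ?addr0 // => l lj.
  by rewrite (_ : _ == _ = false) ?scale0r //; apply: contraNF lj => /eqP e; apply/eqP/val_inj.
have tu j : (j <= n)%N -> xR (tv (u j)).
  move=> jn; rewrite fE ?leqW // /conv tv_sum.
  apply: (big_ind xR) => // l _; rewrite tvZ.
  have [ln|] := ltnP l n; first by apply: xR_res => //; apply: tf_res.
  move=> nl; have lj : l = j :> nat by apply/eqP; rewrite eqn_leq -ltnS ltn_ord (leq_trans jn nl).
  by rewrite lj subnn q0; exists (tv (f j)).
have [w [w0 wE]] := ua.
have : xR (tv (u n.+1)).
  have -> : u n.+1 = x *: w + \sum_(j < n.+1) a j *: u j by rewrite -wE subrK.
  rewrite tvD; apply: (xRD); first by rewrite tvZ; exists (tv w).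
  rewrite tv_sum; apply: (big_ind xR) => // l _; rewrite tvZ; apply/xRM/tu.
  by rewrite -ltnS.
rewrite fE // /conv tv_sum !big_ord_recr /= subSnn subnn !tvZ q0.
move=> [d dE].
have [e eE] : xR (\sum_(l < n) tv (q (n.+1 - l)%N *: f l)).
  by apply: (big_ind xR) => // l _; rewrite tvZ; apply: xR_res => //; apply: tf_res.
have [e' e'E] : xR (q 1 * (tv (f n) - 1)).
  by apply: xR_res => //; rewrite rmorphB rmorph1 tf subrr.
case: (q1 (d - e - e' - tv (f n.+1))).
by rewrite eE in dE; rewrite !mulrBr -dE -e'E; ring.
Qed.

End Tower.

(** * Minimal free resolution of the dual module, and its dual complex *)

Definition generates (L : lmodType R) (W : set L) n (e : {linear 'rV[R]_n -> L}) :=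
  forall v, W v <-> exists c, e c = v.

Let drop_generator (L : lmodType R) (W : set L) n (e : {linear 'rV[R]_n.+1 -> L}) c j :
  generates W e -> e c = 0 -> res (c 0 j) != 0 ->
  exists e' : {linear 'rV[R]_n -> L}, generates W e'.
Proof.
move=> eW ec /res_unit [u cu]; exists (e \o mulmxr (row' j 1%:M)) => v.
rewrite eW; split=> [[d <-]|[d <-]]; last by exists (d *m row' j 1%:M).
pose d' := d - (d 0 j * u) *: c.
have d'j : d' 0 j = 0 by rewrite !mxE -mulrA [u * _]mulrC cu mulr1 subrr.
exists (col' j d') => /=.
have -> : col' j d' *m row' j 1%:M = d'.
  apply/rowP => i; rewrite !mxE; under eq_bigr => l _ do rewrite !mxE.
  case: (unliftP j i) => [i'|] -> {i}.
    rewrite (bigD1 i') //= eqxx mulr1 big1 ?addr0 ?mxE // => l li.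
    by rewrite (inj_eq lift_inj) (negbTE li) mulr0.
  rewrite big1 => [|l _]; last by rewrite eq_sym (negbTE (neq_lift _ _)) mulr0.
  by rewrite -d'j !mxE.
by rewrite /d' linearB linearZ /= ec scaler0 subr0.
Qed.

(** With the least number of generators, no relation has a unit coefficient, since it would express
    one generator by the others. *)
Lemma minimal_generators (L : lmodType R) (W : set L) :
  (exists n (e : {linear 'rV[R]_n -> L}), generates W e) ->
  exists n (e : {linear 'rV[R]_n -> L}),
    generates W e /\ forall c, e c = 0 -> map_mx res c = 0.
Proof.
move=> [n0 [e0 gen0]].
have ex : exists n, `[< exists e : {linear 'rV[R]_n -> L}, generates W e >].
  by exists n0; apply/asboolP; exists e0.
case: (ex_minnP ex) => n /asboolP [e gen] n_min; exists n, e; split=> // c ec.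
apply/rowP => j; rewrite !mxE; apply/eqP; apply: contraT => cj.
case: n => [|n] in e gen n_min c ec j cj *; first by case: j {cj}.
have [e' gen'] := drop_generator gen ec cj.
have /n_min : `[< exists e : {linear 'rV[R]_n -> L}, generates W e >].
  by apply/asboolP; exists e'.
by rewrite ltnn.
Qed.

Lemma minimal_kernel m (L : lmodType R) (e : {linear 'rV[R]_m -> L}) :
  exists p (A : 'M[R]_(p, m)), (forall v : 'rV_m, e v = 0 <-> exists c, c *m A = v) /\
    forall c : 'rV_p, c *m A = 0 -> map_mx res c = 0.
Proof.
have [|p0 [A0 A0P]] := @noetherian_rV R m [set v | e v = 0] R_noeth.
  split=> [|u v /= eu ev|c v /= ev]; first exact: linear0.
    by rewrite linearD eu ev addr0.
  by rewrite linearZ /= ev scaler0.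
have [|p [g [gen g_min]]] := @minimal_generators 'rV[R]_m [set v | e v = 0].
  exists p0, (mulmxr A0) => v; rewrite A0P.
  by split=> -[c cE]; exists c; rewrite // cE.
have gE c : g c = c *m \matrix_i g (delta_mx 0 i).
  by rewrite linear_rV mulmx_sum_row; apply: eq_bigr => i _; rewrite rowK.
exists p, (\matrix_i g (delta_mx 0 i)); split=> [v|c]; last by rewrite -gE; apply: g_min.
split=> [ev|[c cE]].
  by have [c cE] := proj1 (gen v) ev; exists c; rewrite -gE.
by apply: (proj2 (gen v)); exists c; rewrite gE.
Qed.

(** Evaluation at generators of [X] embeds the dual into [R^n], whose submodules are finitely
    generated. *)
Lemma dual_fin_gen (X : lmodType R) : fin_gen X ->
  exists n (e : {linear 'rV[R]_n -> dual X}), generates setT e.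
Proof.
move=> [n [g gP]].
have ev_lin : linear (fun f : dual X => \row_i (f (g i) : R)).
  by move=> a f h; apply/rowP => i; rewrite !mxE.
have ev_inj (f h : dual X) : (forall i, f (g i) = h (g i)) -> f = h.
  move=> fh; apply/val_inj/funext => v; have [c ->] := gP v.
  rewrite -[LHS]/((mklin (@dual_linear R X f)) _) -[RHS]/((mklin (@dual_linear R X h)) _).
  rewrite !linear_sum; apply: eq_bigr => i _; rewrite !linearZ /=; congr (_ *: _); exact: fh.
have [|m [B BP]] := @noetherian_rV R n [set v | exists f : dual X, mklin ev_lin f = v] R_noeth.
  split; first by exists 0; rewrite linear0.
    by move=> _ _ [f <-] [h <-]; exists (f + h); rewrite linearD.
  by move=> c _ [f <-]; exists (c *: f); rewrite linearZ.
have /choice[h hE] : forall i, exists f : dual X, mklin ev_lin f = row i B.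
  by move=> i; apply/BP; exists (delta_mx 0 i); rewrite -rowE.
have [e eE] := linear_rV_exists h; exists m, e => f; split=> // _.
have /BP [c cE] : exists f' : dual X, mklin ev_lin f' = mklin ev_lin f by exists f.
exists c; apply: ev_inj => i.
have : mklin ev_lin (e c) = mklin ev_lin f.
  rewrite eE linear_sum cE mulmx_sum_row; apply: eq_bigr => j _.
  by rewrite linearZ /= -hE.
by move=> /rowP /(_ i); rewrite !mxE.
Qed.

(** On rows the matrices [D] resolve the dual of [X] minimally; on columns they form the dual
    complex. The latter is exact by the vanishing of Ext of the dual and starts with [X] by
    biduality, while exactness of the former lets forms vanishing on [ker D] factor through [D]. *)
Lemma minimal_coresolution (X : lmodType R) : Gdim0 X ->
  exists (c : nat -> nat) (D : forall i, 'M[R]_(c i.+1, c i)) (eta : X -> 'cV[R]_(c 0)),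
  [/\ forall i, map_mx res (D i) = 0, forall i, D i.+1 *m D i = 0,
      forall i (w : 'cV_(c i.+1)), D i.+1 *m w = 0 -> exists f, w = D i *m f,
      forall i (p : 'rV_(c i)), (forall v : 'cV_(c i), D i *m v = 0 -> p *m v = 0) ->
        exists p', p = p' *m D i &
      [/\ linear eta, forall w, D 0 *m w = 0 <-> exists v, eta v = w &
          forall f : {linear X -> R^o}, exists p : 'rV_(c 0), forall v, f v = (p *m eta v) 0 0]].
Proof.
move=> [X_fg [bid _ bidK] _ X_ext].
have [c0 [e [e_gen e_min]]] := minimal_generators (dual_fin_gen X_fg).
have e_onto f : exists c, e c = f by apply/e_gen.
pose h i := e (delta_mx 0 i).
pose eta (v : X) : 'cV[R]_c0 := \col_i (h i v : R).
have eE p v : e p v = (p *m eta v) 0 0.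
  rewrite mxE linear_rV.
  have evlin : linear (fun f : dual X => f v : R^o) by [].
  rewrite -[LHS]/(mklin evlin _) linear_sum; apply: eq_bigr => i _.
  by rewrite linearZ mxE.
have eta_lin : linear eta.
  by move=> a u v; apply/colP => i; rewrite !mxE dual_linear.
have [c1 [D0 [D0_ker D0_min]]] := minimal_kernel e.
(* A stage bundles a matrix with its sizes and the minimality of its rows as generators, so that the
   resolution arises by plain iteration on one type. *)
pose stage := {c : nat & {c' : nat & {A : 'M[R]_(c', c) |
  forall v : 'rV_c', v *m A = 0 -> map_mx res v = 0}}}.
pose size1 (s : stage) := projT1 s.
pose size2 (s : stage) := projT1 (projT2 s).
pose mat (s : stage) : 'M[R]_(size2 s, size1 s) := sval (projT2 (projT2 s)).
have mat_min s (v : 'rV_(size2 s)) : v *m mat s = 0 -> map_mx res v = 0.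
  exact: (svalP (projT2 (projT2 s))).
have ex_next : forall s : stage, exists s' : {c' : nat & {A : 'M[R]_(c', size2 s) |
    forall v : 'rV_c', v *m A = 0 -> map_mx res v = 0}},
    forall v : 'rV_(size2 s), v *m mat s = 0 <->
      exists c : 'rV_(projT1 s'), c *m sval (projT2 s') = v.
  move=> s; have [p [A [A_ker A_min]]] := minimal_kernel (mulmxr (mat s)).
  by exists (existT _ p (exist _ A A_min)).
pose next s := sval (cid (ex_next s)).
have nextP s := svalP (cid (ex_next s)).
pose nx s : stage := existT _ (size2 s) (next s).
pose s0 : stage := existT _ c0 (existT _ c1 (exist _ D0 D0_min)).
pose st i := iter i nx s0.
pose c i := size1 (st i).
pose D i : 'M[R]_(c i.+1, c i) := mat (st i).
have D_rows i (v : 'rV_(c i.+1)) : v *m D i = 0 <-> exists w, w *m D i.+1 = v.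
  exact: nextP.
have D_inj i (v : 'rV_(c i.+1)) : v *m D i = 0 -> map_mx res v = 0 := @mat_min (st i) v.
have DD i : D i.+1 *m D i = 0.
  apply/row_matrixP => j; rewrite row_mul row0; apply/D_rows.
  by exists (delta_mx 0 j); rewrite -rowE.
have D_min i : map_mx res (D i) = 0.
  apply/row_matrixP => j; rewrite -map_row row0; case: i j => [|i] j.
    by apply: e_min; apply/D0_ker; exists (delta_mx 0 j); rewrite -rowE.
  by apply: D_inj; rewrite -row_mul DD row0.
pose dif i : {linear 'rV[R]_(c i.+1) -> 'rV[R]_(c i)} := mulmxr (D i).
pose Q := @ProjResolution R (dual X) (fun i => 'rV[R]_(c i)) dif e
  (fun i => @projective_rV R (c i)) e_onto D0_ker (fun i => @D_rows i).
exists c, D, eta; split=> //.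
- move=> i w Dw.
  have lin : linear (fun v : 'rV[R]_(c i.+1) => (v *m w) 0 0 : R^o).
    by move=> a u v; rewrite mulmxDl -scalemxAl !mxE.
  have [|g gE] := X_ext i Q (mklin lin).
    by move=> v; rewrite /= -mulmxA Dw mulmx0 mxE.
  have [f fE] := linear_form_rV g; exists f; apply/colP => j.
  have := gE (delta_mx 0 j); rewrite fE /= -mulmxA -!rowE.
  by rewrite [LHS]mxE [RHS]mxE.
(* Testing [p] on the image of [eta], respectively on the columns of the previous differential,
   shows that it is a cycle of the resolution. *)
- move=> [|i] p pP.
    have [a aE] : exists a, a *m D0 = p; last by exists a.
    apply/D0_ker/val_inj/funext => v.
    rewrite -[LHS]/(e p v) -[RHS]/(0 : R) eE pP ?mxE //.
    apply/colP => j; rewrite [RHS]mxE.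
    have : e (row j D0) v = 0.
      suff -> : e (row j D0) = 0 by [].
      by apply/D0_ker; exists (delta_mx 0 j); rewrite -rowE.
    by rewrite eE -row_mul [row _ _ _ _]mxE.
  have [a aE] : exists a, a *m D i.+1 = p; last by exists a.
  apply/D_rows/rowP => j; rewrite [RHS]mxE.
  have /matrixP /(_ 0 0) : p *m col j (D i) = 0.
    by apply: pP; rewrite colE mulmxA DD mul0mx.
  by rewrite colE mulmxA -colE [col _ _ _ _]mxE [RHS]mxE.
split=> // [w|f].
  split=> [D0w|[v <-]]; last first.
    apply/colP => j; rewrite [RHS]mxE.
    have : e (row j D0) v = 0.
      suff -> : e (row j D0) = 0 by [].
      by apply/D0_ker; exists (delta_mx 0 j); rewrite -rowE.
    by rewrite eE -row_mul [row _ _ _ _]mxE.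
  have [s sK] := choice e_onto.
  have sE p : s (e p) *m w = p *m w.
    apply/eqP; rewrite -subr_eq0 -mulmxBl.
    have /D0_ker [a <-] : e (s (e p) - p) = 0 by rewrite linearB sK subrr.
    by rewrite -mulmxA [D0 *m w]D0w mulmx0.
  (* A column killed by [D 0] descends to a form on the dual, which biduality represents by an
     element of [X]. *)
  have Psi_lin : linear (fun f : dual X => (s f *m w) 0 0 : R^o).
    move=> a f f'; rewrite -[f]sK -[f']sK -linearP !sE mulmxDl -scalemxAl !mxE.
    by [].
  have Psi_pred : (fun f : dual X => (s f *m w) 0 0 : R^o) \in @dual_pred R (dual X).
    exact/asboolP.
  exists (bid (Dual Psi_pred)); apply/colP => j; rewrite mxE.
  have := congr1 (fun F : dual (dual X) => F (h j)) (bidK (Dual Psi_pred)).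
  rewrite /= => ->; rewrite sE.
  by rewrite -rowE mxE.
have f_pred : (f : X -> R^o) \in @dual_pred R X.
  by apply/asboolP => a u v; rewrite linearP.
have [p pE] := e_onto (Dual f_pred); exists p => v.
by rewrite -eE pE.
Qed.


(** The family consists of [1], generators [g_i] of the maximal ideal [m], and the [x g_i]:
    replacing coefficients by their residues leaves errors in [m^2 = x m], and then in [m^3 = 0]. *)
Lemma finite_basis : exists N (b : 'cV[R]_N), forall a,
  exists c : 'rV[k]_N, a = (map_mx iota c *m b) 0 0.
Proof.
have [|l lP] := R_noeth (I := [set a | res a = 0]).
  split=> [|a b /= a0 b0|c a /= a0] /=; first by rewrite rmorph0.
    by rewrite rmorphD a0 b0 addr0.
  by rewrite rmorphM a0 mulr0.
pose g := \col_i l`_i : 'cV[R]_(size l).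
have g_res i : res (g i 0) = 0.
  have : ideal_gen [set` l] (g i 0) by rewrite mxE; apply/ideal_gen_sub/mem_nth.
  by rewrite -lP.
have split_row (d : 'rV[R]_(size l)) : exists (c : 'rV[k]_(size l)) a,
    res a = 0 /\ (d *m g) 0 0 = (map_mx iota c *m g) 0 0 + x * a.
  have /choice[a aP] : forall i, exists a, res a = 0 /\ (d 0 i - iota (res (d 0 i))) * g i 0 = x * a.
    by move=> i; apply: res_mul => //; rewrite rmorphB resK subrr.
  exists (map_mx res d), (\sum_i a i); split.
    by rewrite rmorph_sum big1 // => i _; case: (aP i).
  rewrite !mxE mulr_sumr -big_split; apply: eq_bigr => i _ /=.
  by rewrite -(proj2 (aP i)) 2![map_mx _ _ _ _]mxE mulrBl addrC subrK.
have res_gen a : res a = 0 -> exists d : 'rV[R]_(size l), a = (d *m g) 0 0.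
  by move=> a0; apply/ideal_genP; rewrite -lP.
exists (1 + (size l + size l))%N, (col_mx (const_mx 1) (col_mx g (x *: g))) => a.
have [d dE] : exists d : 'rV[R]_(size l), a - iota (res a) = (d *m g) 0 0.
  by apply: res_gen; rewrite rmorphB resK subrr.
have [c [a1 [a10 dE1]]] := split_row d; have [d2 d2E] := res_gen _ a10.
have [c2 [a2 [a20 dE2]]] := split_row d2.
exists (row_mx (const_mx (res a)) (row_mx c c2)).
rewrite !map_row_mx !mul_row_col -scalemxAr [RHS]mxE [X in _ + X]mxE [X in _ + (_ + X)]mxE.
rewrite -[a in LHS](subrK (iota (res a))) dE dE1 d2E dE2 mulrDr.
rewrite [x * (x * a2)]mulrA xx0 mul0r addr0 addrC; congr (_ + _).
by rewrite mxE big_ord1 !mxE mulr1.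
Qed.

Lemma independent_length_bound : exists N, forall n c (u : nat -> 'cV[R]_c),
  (forall j, (j <= n)%N -> ~ exists a : nat -> R, in_m2 (u j - \sum_(l < j) a l *: u l)) ->
  (n < N * c)%N.
Proof.
have [N [b bP]] := finite_basis; exists N => n c u u_indep.
rewrite ltnNge; apply/negP => le_n.
have /choice[C CE] : forall ji : nat * 'I_c, exists C : 'rV[k]_N,
    u ji.1 ji.2 0 = (map_mx iota C *m b) 0 0 by move=> ji; apply: bP.
pose U : 'M[k]_(n.+1, N * c) := \matrix_j mxvec (\matrix_(l, i) C (nat_of_ord j, i) 0 l).
have : kermx U != 0.
  rewrite kermx_eq0 /row_free neq_ltn; apply/orP; left.
  by rewrite (leq_ltn_trans (rank_leq_col U)).
move=> /rowV0Pn [w /sub_kermxP wU w0].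
have rel : \sum_(j < n.+1) iota (w 0 j) *: u j = 0.
  apply/colP => i; rewrite summxE [RHS]mxE.
  have wC l : \sum_(j < n.+1) w 0 j * C (nat_of_ord j, i) 0 l = 0.
    have := congr1 (fun X : 'rV_(N * c) => X 0 (mxvec_index l i)) wU.
    rewrite [RHS]mxE mxE => e; rewrite -[RHS]e; apply: eq_bigr => j _.
    by rewrite mxE mxvecE mxE.
  transitivity (\sum_(j < n.+1) \sum_l iota (w 0 j * C (nat_of_ord j, i) 0 l) * b l 0).
    apply: eq_bigr => j _; rewrite mxE (CE (nat_of_ord j, i)) mxE mulr_sumr.
    by apply: eq_bigr => l _; rewrite mxE rmorphM mulrA.
  rewrite exchange_big big1 // => l _ /=.
  by rewrite -mulr_suml -rmorph_sum wC rmorph0 mul0r.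
have [j1 wj1] : exists j, w 0 j != 0.
  apply: contrapT => no; move/eqP: w0; apply; apply/rowP => j; rewrite [RHS]mxE.
  by apply/eqP; apply: contra_notT no => nj; exists j.
pose wn (j : nat) := w 0 (inord j).
(* The last index with a nonzero coefficient, so that [u j] is a combination of strictly earlier
   vectors. *)
have [j wj j_max] := @arg_maxnP _ j1 (fun j => w 0 j != 0) (@nat_of_ord n.+1) wj1.
have wnE (l : 'I_n.+1) : wn l = w 0 l by rewrite /wn inord_val.
have rel' : \sum_(l < j) iota (wn l) *: u l + iota (wn j) *: u j = 0.
  rewrite -(big_ord_recr j (fun l => iota (wn l) *: u l)) /=.
  rewrite -[RHS]rel -(big_mkord xpredT (fun l => iota (wn l) *: u l)).
  transitivity (\sum_(0 <= l < n.+1) iota (wn l) *: u l); last first.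
    by rewrite big_mkord; apply: eq_bigr => l _; rewrite wnE.
  rewrite [RHS](@big_cat_nat _ _ _ j.+1) //=.
  rewrite [X in _ = _ + X]big1_seq ?addr0 // => l; rewrite mem_index_iota => /andP[_ /andP[jl ln]].
  have -> : wn l = w 0 (Ordinal ln) by rewrite -wnE.
  have [->|wl] := eqVneq (w 0 (Ordinal ln)) 0; first by rewrite rmorph0 scale0r.
  by have := j_max _ wl; rewrite /= leqNgt jl.
apply: (u_indep j); first by rewrite -ltnS.
exists (fun l => - iota (wn l / wn j)); exists 0; rewrite map_mx0 scaler0; split=> //.
have wjn : wn j != 0 by rewrite wnE.
have : iota (wn j)^-1 *: (\sum_(l < j) iota (wn l) *: u l + iota (wn j) *: u j) = 0.
  by rewrite rel' scaler0.
rewrite scalerDr scaler_sumr scalerA -rmorphM mulVf // rmorph1 scale1r addrC => e.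
rewrite -[RHS]e; congr (_ + _); rewrite -sumrN; apply: eq_bigr => l _.
by rewrite scaleNr opprK scalerA -rmorphM mulrC.
Qed.

Lemma half_pair_toeplitz p q :
  (forall j, res (p j) = 0) -> p 0 = x -> (forall b, p 1 <> x * b) ->
  (forall n, exact_pair (toeplitz p n) (toeplitz q n)) -> half_pair p q.
Proof.
move=> p_res p0 p1 pq; split=> // n N u pu.
have conv_toep (r : nat -> R) (v : nat -> R) (j : 'I_N.+1) :
    (toeplitz r N.+1 *m \col_i v i) j 0 = \sum_(l < j.+1) r (j - l)%N * v l.
  rewrite mxE (eq_bigr (fun l : 'I_N.+1 => if (l <= j)%N then r (j - l)%N * v l else 0)); last first.
    by move=> l _; rewrite !mxE; case: ifP; rewrite ?mul0r.
  rewrite -big_mkcond /= (big_ord_widen_cond N.+1 xpredT (fun l => r (j - l)%N * v l) (ltn_ord j)).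
  by apply: eq_bigl => l; rewrite ltnS.
have /choice[f fE] : forall i : 'I_n, exists w, \col_(j < N.+1) u j i 0 = toeplitz q N.+1 *m w.
  move=> i; apply/(exact_pair_col _ (pq N.+1))/colP => j; rewrite [RHS]mxE.
  rewrite (conv_toep p (fun j => u j i 0)).
  have /colP /(_ i) := pu j (ltn_ord j); rewrite /conv summxE [RHS]mxE => e.
  by rewrite -[RHS]e; apply: eq_bigr => l _; rewrite mxE.
exists (fun j => \col_i f i (inord j) 0) => j jN; apply/colP => i.
have /colP /(_ (inord j)) := fE i.
have -> : f i = \col_(l < N.+1) (fun l : nat => f i (inord l) 0) l.
  by apply/colP => l; rewrite mxE inord_val.
rewrite (conv_toep q (fun l => f i (inord l) 0)) mxE !inordK // => ->.
by rewrite /conv summxE; apply: eq_bigr => l _; rewrite !mxE.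
Qed.

Lemma no_approximation (p q : nat -> R) (K : lmodType R) (kappa : {linear R^o -> K}) :
  is_onto kappa -> (forall a, kappa a = 0 <-> res a = 0) ->
  (forall j, res (p j) = 0) -> p 0 = x -> (forall b, p 1 <> x * b) ->
  (forall j, res (q j) = 0) -> q 0 = x -> (forall b, q 1 <> x * b) ->
  (forall n, exact_pair (toeplitz p n) (toeplitz q n)) ->
  ~ exists (X : lmodType R) (pi : {linear X -> K}), G_approximation pi.
Proof.
move=> kappa_onto kappa_ker p_res p0 p1 q_res q0 q1 pq [X [pi [_ X_G approx]]].
have pair : series_pair p q.
  by split; apply: half_pair_toeplitz => // n; apply: exact_pair_sym.
have [c [D [eta [D_min DD D_exact D_dual [eta_lin eta_ker eta_dual]]]]] := minimal_coresolution X_G.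
have etaL : exists e : {linear X -> 'cV[R]_(c 0)}, forall v, e v = eta v.
  by exists (mklin eta_lin).
have [e eE] := etaL.
(* The [n + 1] vectors [e (u 0), ..., e (u n)] will be independent, whereas [bound] then forces
   [n < N * c 0]. *)
have [N bound] := independent_length_bound; pose n := (N * c 0)%N.
have [M [g [g_onto g_ker M_G]]] := exact_pair_Gdim0 (pq n.+1).
have [s sK] := choice g_onto.
have kappaE a b : res a = res b -> kappa a = kappa b.
  move=> ab; apply/eqP; rewrite -subr_eq0 -linearB; apply/eqP/kappa_ker.
  by rewrite rmorphB ab subrr.
have toep_res i j : res (toeplitz p n.+1 i j) = 0.
  by rewrite mxE; case: (_ <= _)%N; rewrite ?p_res ?rmorph0.
have g_res v w : g v = g w -> kappa (v 0 0 : R^o) = kappa (w 0 0 : R^o).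
  move=> vw; apply: kappaE; have /g_ker [t /rowP /(_ 0)] : g (v - w) = 0.
    by rewrite linearB vw subrr.
  rewrite !mxE => e0; apply/eqP; rewrite -subr_eq0 -rmorphB e0 rmorph_sum big1 // => j _.
  by rewrite rmorphM; have := toep_res j 0; rewrite mxE => ->; rewrite mulr0.
have f_lin : linear (fun z : M => kappa (s z 0 0 : R^o)).
  move=> a z z'; rewrite -linearP.
  rewrite (g_res (s (a *: z + z')) (a *: s z + s z')); last by rewrite linearP !sK.
  by rewrite !mxE.
have [h hE] := approx M (mklin f_lin) M_G.
pose u (j : nat) : X := h (g (delta_mx 0 (inord j))).
have u_tower (j : nat) : (j <= n)%N -> \sum_(l < j.+1) p (j - l)%N *: u l = 0.
  move=> jn; have jn' : (j < n.+1)%N by [].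
  have : g (row (Ordinal jn') (toeplitz p n.+1)) = 0.
    by apply/g_ker; exists (delta_mx 0 (Ordinal jn')); rewrite -rowE.
  move=> /(congr1 h); rewrite linear0 linear_rV linear_sum => e0.
  rewrite -[RHS]e0 (big_ord_widen_cond n.+1 xpredT (fun l => p (j - l)%N *: u l) jn').
  rewrite big_mkcond; apply: eq_bigr => l _ /=; rewrite linearZ !mxE /= ltnS.
  by case: ifP => // _; rewrite ?scale0r // /u inord_val.
have pi_u0 : pi (u 0) = kappa 1.
  rewrite -hE /=; have -> : kappa 1 = kappa ((delta_mx 0 (inord 0) : 'rV[R]_n.+1) 0 0 : R^o).
    by rewrite mxE (_ : inord 0 = 0) ?eqxx //; apply/val_inj; rewrite /= inordK.
  by apply: g_res; rewrite sK.
have De v : D 0 *m e v = 0 by apply/eta_ker; exists v.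
(* [sig] is [pi] followed by the embedding of the residue field as the line [R x y1]. Extended to
   [F_0] it has coefficients in [m] and so kills [m^2 F_0]; its value [x y1] at [u 0] then shows
   that the tower starts at a good element. *)
have [sig sigE] : exists sig : {linear X -> R^o}, forall v a, pi v = kappa a -> sig v = x * y1 * a.
  have /choice[r rE] : forall v, exists a, kappa a = pi v by move=> v; apply: kappa_onto.
  have same a b : kappa a = kappa b -> x * y1 * a = x * y1 * b.
    move=> ab; apply/eqP; rewrite -subr_eq0 -mulrBr mulrC; apply/eqP/mul3 => //.
    by apply/kappa_ker; rewrite linearB ab subrr.
  have lin : linear (fun v => x * y1 * r v : R^o).
    move=> a v w; rewrite -[RHS]/(a * (x * y1 * r v) + x * y1 * r w).
    transitivity (x * y1 * (a * r v + r w)); last by ring.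
    by apply: same; rewrite rE linearP -!rE -linearP.
  by exists (mklin lin) => v a va /=; apply: same; rewrite rE.
have [t tE] := eta_dual sig.
have t_res : map_mx res t = 0.
  apply: socle_form => v v2; have /eta_ker [v' v'E] := mulmx_in_m2 (D_min 0) v2.
  have [a aE] := kappa_onto (pi v'); exists a.
  by rewrite -v'E -tE (sigE _ _ (esym aE)) mulrC.
apply: (negP (negbT (ltnn n))); apply: (bound n (c 0) (fun j => e (u j))) => j jn.
apply: (@tower_independent c D D_min DD D_exact D_dual j p q 0 (fun j => e (u j)) pair).
- by move=> l _.
- move=> l lj; rewrite /conv; transitivity (e (\sum_(i < l.+1) p (l - i)%N *: u i)).
    by rewrite linear_sum; apply: eq_bigr => i _; rewrite linearZ.
  by rewrite u_tower ?linear0 // (leq_trans lj).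
move=> [_ [/eta_ker [v <-] uv]].
have [a aE] := kappa_onto (pi v).
have : sig (u 0 - x *: v) = 0.
  by rewrite tE -eE linearB linearZ /= (eE v) (mulmx_in_m2 t_res uv) mxE.
rewrite (sigE _ (1 - x * a)); last by rewrite linearB linearZ /= pi_u0 -aE -linearZ -linearB.
have xya : x * y1 * (x * a) = 0.
  by transitivity (x * x * (y1 * a)); [ring | rewrite xx0 mul0r].
rewrite mulrBr mulr1 xya subr0.
by move=> /x_ann [b /y1_x].
Qed.

End LocalRing.

Theorem theorem6p1 (k : fieldType) (r : nat) (S : comNzRingType)
  (phi : {rmorphism {mpoly k[r]} -> S})
  (x : S) (R : comNzRingType) (rho : {rmorphism S -> R})
  (K : lmodType R) (kappa : {linear R^o -> K})
  (S_homogeneous : homogeneous_presentation phi)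
  (S_dim1 : krull_dim S 1)
  (S_CM : cohen_macaulay S)
  (S_not_Gorenstein : ~ gorenstein S)
  (S_min_mult : minimal_multiplicity (graded_max_ideal phi))
  (x_min_red : minimal_reduction (graded_max_ideal phi) x)
  (rho_surj : is_onto rho)
  (rho_ker : forall s, rho s = 0 <-> exists t, s = x ^+ 2 * t)
  (kappa_surj : is_onto kappa)
  (kappa_ker : forall a, kappa a = 0 <-> ideal_gen (rho @` graded_max_ideal phi) a) :
  ~ exists (X : lmodType R) (pi : {linear X -> K}), G_approximation pi.
Proof.
have [tau [tau1 tau_homog tau_coef]] := grading_exists S_homogeneous.
have [phi_onto _] := S_homogeneous; have [S_noeth _] := S_CM.
have x_reg a : x * a = 0 -> a = 0.
  exact: (reduction_regular tau1 tau_homog tau_coef S_dim1 S_CM x_min_red).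
set n := graded_max_ideal phi in S_min_mult x_min_red kappa_ker *.
have [n0 nD nM] : is_ideal n by apply: graded_max_ideal_ideal.
have nN a : n a -> n (- a) by move=> na; rewrite -mulN1r; apply: nM.
have n1 : ~ n 1 by apply: (graded_max_ideal_proper tau1 tau_homog tau_coef).
have nn a b : n a -> n b -> exists c, n c /\ a * b = x * c.
  exact: (red_mul x_min_red).
have nx : n x by case: x_min_red.
pose jota := scalar_map phi.
have dec s : exists c, n (s - jota c) by apply: (scalar_decomposition tau1 tau_homog tau_coef).
have jota_n c : n (jota c) -> c = 0.
  move=> nc; have [//|cn] := eqVneq c 0; case: n1.
  by rewrite -(scalar_unit phi cn) mulrC; apply: nM.
(* Applied to [0] and then to [z1], this yields two elements of [n] independent over [k] modulo
   [x S]. *)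
have not_two y : exists a, n a /\ forall t c, a <> x * t + jota c * y.
  apply: contrapT => no; apply: S_not_Gorenstein.
  apply: (two_generated_gorenstein tau1 tau_homog tau_coef S_dim1 S_CM x_min_red (y := y)).
  move=> a na; apply: contrapT => no_a; apply: no; exists a; split=> // t c e.
  by apply: no_a; exists t, c.
have [z1 [nz1 z1P]] := not_two 0.
have [z2 [nz2 z2P]] := not_two z1.
have rho_x2 : rho (x ^+ 2) = 0 by apply/rho_ker; exists 1; rewrite mulr1.
have rho_n s t : rho s = rho t -> n t -> n s.
  move=> st nt; have /rho_ker [u uE] : rho (s - t) = 0 by rewrite rmorphB st subrr.
  by rewrite -(subrK t s) uE; apply: nD => //; rewrite mulrC expr2 mulrA; apply: nM.
pose iota : {rmorphism k -> R} := rho \o jota.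
(* The residue of [a] is the scalar of any lift modulo [n]; lifts differ by multiples of [x^2],
   which lie in [n]. *)
have /choice[res0 res0P] : forall a, exists c, forall s, rho s = a -> n (s - jota c).
  move=> a; have [s <-] := rho_surj a; have [c nc] := dec s; exists c => t ts.
  by apply: (rho_n _ (s - jota c)) => //; rewrite !rmorphB ts.
have res0E s c : n (s - jota c) -> res0 (rho s) = c.
  move=> nc; apply/eqP; rewrite -subr_eq0; apply/eqP/jota_n; rewrite rmorphB.
  have -> : jota (res0 (rho s)) - jota c = (s - jota c) + - (s - jota (res0 (rho s))) by ring.
  by apply/nD/nN/res0P.
have res0B : zmod_morphism res0.
  move=> a b; have [s <-] := rho_surj a; have [t <-] := rho_surj b.
  rewrite -rmorphB; apply: res0E; rewrite rmorphB.
  set c := res0 (rho s); set d := res0 (rho t).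
  have -> : s - t - (jota c - jota d) = (s - jota c) + - (t - jota d) by ring.
  by apply: nD; [apply: res0P | apply/nN/res0P].
have res0M : monoid_morphism res0.
  split; first by rewrite -(rmorph1 rho); apply: res0E; rewrite rmorph1 subrr.
  move=> a b; have [s <-] := rho_surj a; have [t <-] := rho_surj b.
  rewrite -rmorphM; apply: res0E; rewrite rmorphM.
  set c := res0 (rho s); set d := res0 (rho t).
  have -> : s * t - jota c * jota d = t * (s - jota c) + jota c * (t - jota d) by ring.
  by apply: nD; apply/nM/res0P.
pose res : {rmorphism R -> k} := HB.pack res0
  (GRing.isZmodMorphism.Build _ _ res0 res0B) (GRing.isMonoidMorphism.Build _ _ res0 res0M).
have resE s : res (rho s) = 0 <-> n s.
  split=> [e|ns]; last by apply: res0E; rewrite rmorph0 subr0.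
  have e0 : res0 (rho s) = 0 := e.
  by have := res0P _ s erefl; rewrite e0 rmorph0 subr0.
have resK c : res (iota c) = c by apply: res0E; rewrite subrr.
have res_mul a b : res a = 0 -> res b = 0 -> exists c, res c = 0 /\ a * b = rho x * c.
  have [s <-] := rho_surj a; have [t <-] := rho_surj b => /resE ns /resE nt.
  have [c [nc e]] := nn s t ns nt; exists (rho c).
  by split; [apply/resE | rewrite -!rmorphM e].
have x_ann a : rho x * a = 0 <-> exists b, a = rho x * b.
  split=> [|[b ->]]; last by rewrite mulrA -rmorphM -expr2 rho_x2 mul0r.
  have [s <-] := rho_surj a; rewrite -rmorphM => /rho_ker [t e].
  exists (rho t); rewrite -rmorphM; congr (rho _); apply/eqP; rewrite -subr_eq0.
  by apply/eqP/x_reg; rewrite mulrBr e; ring.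
have z1_x b : rho z1 <> rho x * b.
  have [t <-] := rho_surj b; rewrite -rmorphM => e.
  have /rho_ker [u uE] : rho (z1 - x * t) = 0 by rewrite rmorphB e subrr.
  apply: (z1P (t + x * u) 0); rewrite mulr0 addr0 -[z1](subrK (x * t)) uE; ring.
have z2_xz1 a b : rho z2 <> rho x * a + b * rho z1.
  have [s <-] := rho_surj a; have [t <-] := rho_surj b; rewrite -!rmorphM -rmorphD => e.
  have /rho_ker [u uE] : rho (z2 - (x * s + t * z1)) = 0 by rewrite rmorphB e subrr.
  (* As [n z1] lies in [x S], the coefficient [t] of [z1] may be replaced by its scalar part [c],
     and independence over [k] suffices. *)
  have [c nc] := dec t; have [d [_ dE]] := nn _ _ nc nz1.
  apply: (z2P (s + d + x * u) c); rewrite -[z2](subrK (x * s + t * z1)) uE.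
  by rewrite -{1}(subrK (jota c) t) [(t - _ + _) * z1]mulrDl dE; ring.
have R_noeth : noetherian R.
  move=> I [I0 ID IM]; have [|l lP] := S_noeth [set s | I (rho s)].
    split=> [|a b /= Ia Ib|c a /= Ia] /=; first by rewrite rmorph0.
      by rewrite rmorphD; apply: ID.
    by rewrite rmorphM; apply: IM.
  exists (map rho l); apply/seteqP; split=> a.
    have [s <-] := rho_surj a => Is; have : ideal_gen [set` l] s by rewrite -lP.
    move=> [m [c [b [bl ->]]]]; exists m, (rho \o c), (rho \o b).
    split=> [i|] /=; first by apply: map_f; apply: bl.
    by rewrite rmorph_sum; apply: eq_bigr => i _; rewrite rmorphM.
  apply: ideal_gen_min => // _ /= /mapP [s sl ->].
  have : ideal_gen [set` l] s by apply: ideal_gen_sub.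
  by rewrite -lP.
(* The coefficients of [x^2 / (x - z1 t)], formally [z1^j / x^(j-1)]; the divisions can be done
   inside [n] because [n^2 = x n]. *)
have [z [z_n z0 z_rec]] : exists z : nat -> S,
    [/\ forall j, n (z j), z 0 = x & forall j, x * z j.+1 = z1 * z j].
  have /choice[nxt nxtP] : forall a, exists b, n a -> n b /\ x * b = z1 * a.
    move=> a; have [na|] := pselect (n a); last by exists 0.
    by have [c [nc e]] := nn _ _ nz1 na; exists c.
  have zn j : n (iter j nxt x).
    by elim: j => //= j IH; case: (nxtP _ IH).
  exists (fun j => iter j nxt x); split=> // j.
  by case: (nxtP _ (zn j)).
have zz1 : z 1 = z1.
  by apply/eqP; rewrite -subr_eq0; apply/eqP/x_reg; rewrite mulrBr z_rec z0; ring.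
pose p j := match j with 0 => x | 1 => - z1 | _ => 0 end.
have pz m : toeplitz p m *m toeplitz z m = (x ^+ 2)%:M.
  rewrite toeplitzM toeplitz_scalar => [|j]; first by rewrite big_ord1 /= z0.
  rewrite big_ord_recr /= subnn big_ord_recr /= subSnn big1 => [|i _].
    by rewrite add0r /= z_rec; ring.
  rewrite subSn ?(ltnW (ltn_ord i)) //.
  by case: (j - i)%N (subn_gt0 i j) => [|l _]; rewrite ?ltn_ord //= mul0r.
have zp m : toeplitz z m *m toeplitz p m = (x ^+ 2)%:M.
  by rewrite toeplitzC pz.
have pn j : n (p j) by case: j => [|[|j]] //=; apply: nN.
have kappa_res a : kappa a = 0 <-> res a = 0.
  rewrite kappa_ker; split.
    apply: (@ideal_gen_min R _ [set a | res a = 0]).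
      split=> [|b c b0 c0|c b b0]; rewrite /mkset; first exact: (rmorph0 res).
        by rewrite (rmorphD res) b0 c0 addr0.
      by rewrite (rmorphM res) b0 mulr0.
    by move=> _ [s ns <-]; apply/resE.
  have [s <-] := rho_surj a => /resE ns; apply: ideal_gen_sub.
  by exists s.
apply: (@no_approximation k R iota res (rho x) (rho z1) (rho z2) resK res_mul
  x_ann _ z1_x z2_xz1 _ R_noeth (rho \o p) (rho \o z) K kappa kappa_surj kappa_res) => //=.
- exact/resE.
- exact/resE.
- by move=> j; apply/resE.
- by move=> b; rewrite rmorphN => e; apply: (z1_x (- b)); rewrite mulrN -e opprK.
- by move=> j; apply/resE.
- by rewrite z0.
- by rewrite zz1.
move=> m; rewrite -!map_toeplitz.
apply: (matrix_factorization_exact_pair rho_surj rho_ker _ (pz m) (zp m)) => s.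
by rewrite expr2 -mulrA => /x_reg /x_reg.
Qed.
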